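(* Let $f:\mathbb{R}^n\to\mathbb{R}$ be convex and continuously differentiable, with $|f(x)-f(y)|\le L_0\|x-y\|$ and $\|\nabla f(x)-\nabla f(y)\|\le L_1\|x-y\|$ for all $x,y$, and let $x^*$ be a minimizer of $f$ with $f^*=f(x^* )$. Let $\tilde f(x;\xi)=f(x)[1+\nu(x;\xi)]$, where $\nu$ is i.i.d. (across all evaluations) with $\mathbb{E}[\nu]=0$, variance $\sigma_r^2>0$, $\mathbb{E}[\frac{1}{1+\nu}]\le b$, and support in $[-a,a]$ for some $a<1$. Let $\{x_k\}_{k\ge0}$ be generated from $x_0$ by $$x_{k+1}=x_k-h\,\frac{\tilde f(x_k+\mu_k u_k;\xi_k)-\tilde f(x_k;\xi_{k-1})}{\mu_k}u_k,\qquad \mu_k=C_4\sqrt{|\tilde f(x_k;\xi_{k'})|},$$ where $u_0,u_1,\dots$ are independent standard Gaussian vectors independent of the noise, the three noisy evaluations at each iteration (indexed by $\xi_{k'},\xi_k,\xi_{k-1}$) have independent noise, $C_4=\left[\frac{16\sigma_r^2 n}{L_1^2(1+3\sigma_r^2)(n+6)^3}\right]^{1/4}$, and $h=\frac{1}{4L_1(n+4)}$ (assume $f(x_k)\neq0$ along the iterates, so that $\mu_k>0$). Let $\phi_0=f(x_0)$ and $\phi_k=\mathbb{E}[f(x_k)]$ for $k\ge1$, the expectation over all randomness used up to iteration $k-1$. Let $N\ge0$ and let $M$ satisfy $$M\ge\frac{1}{N+1}\Big(|f(x_0)|+\sum_{k=1}^N\mathbb{E}[|f(x_k)|]\Big).$$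 Then $$\frac{1}{N+1}\sum_{k=0}^N(\phi_k-f^* )\le\frac{4L_1(n+4)}{N+1}\|x_0-x^*\|^2+4L_1(n+4)(C_7M+C_8),$$ where $C_7=\frac{C_4^2 n}{4(n+4)}+\frac{C_5}{16L_1^2(n+4)^2}$, $C_8=\frac{C_6}{16L_1^2(n+4)^2}$, $C_5=\tfrac12C_4^2L_1^2(n+6)^3+(1+b)L_1\sigma_r\sqrt{(1+3\sigma_r^2)n(n+6)^3}$, and $C_6=3L_0^2\sigma_r^2(n+4)^2$.
   Context: $\|\cdot\|$ is the Euclidean norm; ''standard Gaussian'' means mean $0$ and covariance $I_n$. *)

(* Defs.v *)
From HB Require Import structures.
From mathcomp Require Import all_boot all_order all_algebra.
From mathcomp Require Import all_classical all_reals all_analysis.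
Set Implicit Arguments. Unset Strict Implicit. Unset Printing Implicit Defensive.
Import Order.TTheory GRing.Theory Num.Theory.
Import numFieldNormedType.Exports.
Local Open Scope classical_set_scope.
Local Open Scope ring_scope.

Section defs.
Variables (R : realType) (n : nat).

(** Euclidean norm (the library's norm on matrices is the sup norm). *)
Definition enorm (v : 'rV[R]_n) : R := Num.sqrt (\sum_(i < n) v ord0 i ^+ 2).

Definition grad (f : 'rV[R]_n -> R) (x : 'rV[R]_n) : 'rV[R]_n :=
  \row_(i < n) 'D_(delta_mx ord0 i) f x.

Definition convex_fun (f : 'rV[R]_n -> R) : Prop :=
  forall (x y : 'rV[R]_n) (t : R), 0 <= t <= 1 ->
    f (t *: x + (1 - t) *: y) <= t * f x + (1 - t) * f y.

Definition C4 (L1 sigr : R) : R :=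
  Num.sqrt (Num.sqrt ((16 * sigr ^+ 2 * n%:R) /
    (L1 ^+ 2 * (1 + 3 * sigr ^+ 2) * (n%:R + 6) ^+ 3))).
Definition stepsize (L1 : R) : R := 1 / (4 * L1 * (n%:R + 4)).
Definition C5 (L1 sigr b : R) : R :=
  2^-1 * C4 L1 sigr ^+ 2 * L1 ^+ 2 * (n%:R + 6) ^+ 3
  + (1 + b) * L1 * sigr *
    Num.sqrt ((1 + 3 * sigr ^+ 2) * n%:R * (n%:R + 6) ^+ 3).
Definition C6 (L0 sigr : R) : R := 3 * L0 ^+ 2 * sigr ^+ 2 * (n%:R + 4) ^+ 2.
Definition C7 (L1 sigr b : R) : R :=
  C4 L1 sigr ^+ 2 * n%:R / (4 * (n%:R + 4))
  + C5 L1 sigr b / (16 * L1 ^+ 2 * (n%:R + 4) ^+ 2).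
Definition C8 (L0 L1 sigr : R) : R :=
  C6 L0 sigr / (16 * L1 ^+ 2 * (n%:R + 4) ^+ 2).

Variables (d : measure_display) (T : measurableType d).

Definition gvec (g : nat -> 'I_n -> T -> R) (k : nat) (w : T) : 'rV[R]_n :=
  \row_(i < n) g k i w.

(** Noise indices at iteration k: 0 <-> xi_{k'} (evaluation defining mu_k),
    1 <-> xi_k (evaluation at x_k + mu_k u_k), 2 <-> xi_{k-1} (evaluation at x_k). *)
Definition nu_mu (nu : nat -> 'I_3 -> T -> R) k := nu k (inord 0).
Definition nu_plus (nu : nat -> 'I_3 -> T -> R) k := nu k (inord 1).
Definition nu_base (nu : nat -> 'I_3 -> T -> R) k := nu k (inord 2).

Definition noisy (f : 'rV[R]_n -> R) (x : 'rV[R]_n) (v : R) : R := f x * (1 + v).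

Fixpoint iterates (f : 'rV[R]_n -> R) (x0 : 'rV[R]_n) (c4 h : R)
    (nu : nat -> 'I_3 -> T -> R) (g : nat -> 'I_n -> T -> R)
    (k : nat) (w : T) : 'rV[R]_n :=
  match k with
  | 0 => x0
  | k'.+1 =>
    let xk := iterates f x0 c4 h nu g k' w in
    let uk := gvec g k' w in
    let mu := c4 * Num.sqrt `|noisy f xk (nu_mu nu k' w)| in
    xk - (h * ((noisy f (xk + mu *: uk) (nu_plus nu k' w)
                - noisy f xk (nu_base nu k' w)) / mu)) *: uk
  end.

Definition mutually_independent (P : probability T R) (I : eqType)
    (X : I -> T -> R) : Prop :=
  forall (J : seq I) (B : I -> set R), uniq J -> (forall j, measurable (B j)) ->
    P (\bigcap_(j in [set j | j \in J]) (X j @^-1` B j)) =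
    (\prod_(j <- J) P (X j @^-1` B j))%E.

Definition all_randomness (nu : nat -> 'I_3 -> T -> R)
    (g : nat -> 'I_n -> T -> R) : ((nat * 'I_3) + (nat * 'I_n))%type -> T -> R :=
  fun z => match z with inl (k, j) => nu k j | inr (k, i) => g k i end.

End defs.

(* Main.v *)
Require Import Defs.
From HB Require Import structures.
From mathcomp Require Import all_boot all_order all_algebra.
From mathcomp Require Import all_classical all_reals all_analysis.
From mathcomp Require Import measurable_realfun zify ring lra.
Import Order.TTheory GRing.Theory Num.Theory.
Import numFieldNormedType.Exports.
Local Open Scope classical_set_scope.
Local Open Scope ring_scope.

Set Implicit Arguments.
Unset Strict Implicit.
Unset Printing Implicit Defensive.

(** Write u_k for the Gaussian direction and s = mu_k > 0. Expanding
    ||x_{k+1} - x*||^2 and averaging over the two fresh noises leaves the inner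
    product of x_k - x* with E[(f(x_k + s u) - f(x_k)) u / s], which Gaussian
    integration by parts turns into E <grad f(x_k + s u), x_k - x*>; convexity
    and smoothness bound it below by f(x_k) - f* - s^2 L1 n / 2.
    The quadratic term is controlled by the descent lemma, the Lipschitz bound,
    ||grad f||^2 <= 2 L1 (f - f* ) and the moments of ||u||^2 up to order three;
    splitting 2 f(x) (f(x + s u) - f(x)) <= 2 f(x)^2 + (f(x + s u) - f(x))^2 / 2
    makes its noise part fit into C5 and C6. With s^2 = C4^2 |f(x_k)| |1 + nu|,
    averaging over the noise in s gives
    E||x_{k+1} - x*||^2 + h E[f(x_k) - f*]
      <= E||x_k - x*||^2 + h^2 C6 + C7 E|f(x_k)|,
    which telescopes.

    All conditioning is done on the original probability space: [info X A] is
    that space with the sigma-algebra generated by the variables indexed by A,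
    and for disjoint A and B the diagonal integral of F(w, w) equals the double
    integral of F(w, w') (ge0_info_decouple, info_decouple). *)

(** Second moments of the iterates are never shown finite along the way. Each step is an inequality
    between integrals of nonnegative functions in the extended reals, arranged without subtraction;
    finiteness enters only at the end, where [M] bounds the sum of the E|f(x_k)|. The smoothing
    radius is random and depends on the iterate, so a step is averaged in stages: the iterate and
    the noise in mu_k stay frozen while the direction and the two evaluation noises are averaged,
    and the noise in mu_k is averaged last. Smoothing errors carry s^2, proportional to |f(x_k)| |1
    + nu|; the evaluation noises carry f(x_k)^2 / s^2, proportional to |f(x_k)| / |1 + nu|. Taking
    s^2 proportional to |f(x_k)| thus makes both linear in |f(x_k)|, and only E[1/(1+nu)] and [M]
    are needed to bound them. The absolute values keep the integrands nonnegative on the null set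
    where 1 + nu may fail to be positive. The step size is small enough that the gradient part of
    the quadratic term costs at most h (f(x_k) - f xs), half of the decrease 2 h (f(x_k) - f xs)
    supplied by the inner product. *)

(** * Sigma-algebras generated by subfamilies of independent variables *)

Section independence.
Context (d : measure_display) (T : measurableType d) (R : realType).
Context (P : probability T R) (I : eqType) (X : I -> T -> R).
Hypothesis mX : forall i, measurable_fun setT (X i).
Hypothesis indepX : mutually_independent P X.

Definition cylinder (J : seq I) (B : I -> set R) : set T :=
  \bigcap_(j in [set j | j \in J]) (X j @^-1` B j).

Definition cylinders (A : set I) : set (set T) :=
  [set U | exists (J : seq I) (B : I -> set R),
    [/\ uniq J, (forall j, j \in J -> A j), (forall j, measurable (B j)) &
        U = cylinder J B]].

(** The carrier is still [T], so the same function of [w] can be read over either structure;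
    measurability of [Y : info X A -> R] says that [Y] depends only on the variables indexed by
    [A]. *)
Definition info (A : set I) := g_sigma_algebraType (cylinders A).

Lemma cylinders_setI (A : set I) : setI_closed (cylinders A).
Proof.
move=> _ _ [J1 [B1 [u1 A1 m1 ->]]] [J2 [B2 [u2 A2 m2 ->]]].
exists (undup (J1 ++ J2)), (fun j => (if j \in J1 then B1 j else setT) `&`
  (if j \in J2 then B2 j else setT)); split.
- exact: undup_uniq.
- by move=> j; rewrite mem_undup mem_cat => /orP[/A1|/A2].
- by move=> j; apply: measurableI; case: ifP.
- apply/seteqP; split => w /=.
    move=> [w1 w2] j /= _; split.
      by case: ifPn => // j1; exact: w1.
    by case: ifPn => // j2; exact: w2.
  move=> H; split=> j /= jJ; have := H j; rewrite /= mem_undup mem_cat jJ ?orbT.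
    by move=> /(_ isT)[].
  by move=> /(_ isT)[_].
Qed.

Lemma measurable_cylinders (A : set I) : cylinders A `<=` measurable.
Proof.
move=> _ [J [B [_ _ mB ->]]]; rewrite /cylinder.

apply: fin_bigcap_measurable => [|j _]; first exact: finite_seq.
by rewrite -[X in measurable X]setTI; exact: mX.
Qed.

Lemma info_measurable (A : set I) (U : set (info A)) :
  measurable U -> measurable (U : set T).
Proof.
exact: (smallest_sub (@sigma_algebra_measurable _ T) (@measurable_cylinders A)).
Qed.

Lemma measurable_to_info (A : set I) :
  measurable_fun setT (id : T -> info A).
Proof.
by move=> _ U mU; rewrite setTI preimage_id; exact: info_measurable.
Qed.

Lemma measurable_info (A : set I) (i : I) : A i ->
  measurable_fun setT (X i : info A -> R).
Proof.
move=> Ai _ B mB; rewrite setTI; apply: sub_sigma_algebra.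
exists [:: i], (fun=> B); split => //.
  by move=> j; rewrite inE => /eqP ->.
apply/seteqP; split => w /=.
  by move=> Bw j /=; rewrite inE => /eqP ->.
by move=> /(_ i); rewrite /= inE => /(_ (eqxx _)).
Qed.

Lemma info_fun d' (S : measurableType d') (A : set I) (Y : T -> S) :
  measurable_fun setT (Y : info A -> S) -> measurable_fun setT Y.
Proof.
move=> mY; exact: (measurableT_comp mY (@measurable_to_info A)).
Qed.

(** The two index lists are disjoint, so they concatenate to one duplicate-free list with the glued
    family [C], and all three probabilities are instances of [indepX]. *)
Lemma cylinder_indep (A B : set I) U V : A `&` B = set0 ->
  cylinders A U -> cylinders B V -> P (U `&` V) = (P U * P V)%E.
Proof.
move=> AB [J1 [B1 [u1 A1 m1 ->]]] [J2 [B2 [u2 A2 m2 ->]]].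
have dis j : j \in J1 -> j \in J2 -> False.
  by move=> /A1 Aj /A2 Bj; have : (A `&` B) j by []; rewrite AB.
pose C j := if j \in J1 then B1 j else B2 j.
have E2 j : j \in J2 -> C j = B2 j.
  by rewrite /C; case: ifPn => // /dis H /H.
have -> : cylinder J1 B1 `&` cylinder J2 B2 = cylinder (J1 ++ J2) C.
  apply/seteqP; split => w /=.
    move=> [w1 w2] j /=; rewrite mem_cat /C; case: ifPn => // [j1 _|_ /=].
      exact: w1.
    exact: w2.
  move=> H; split=> j /= jJ; have := H j; rewrite /= mem_cat jJ ?orbT.
    by rewrite /C jJ; exact.
  by rewrite E2//; exact.
rewrite /cylinder !indepX//; first last.
- by move=> j; rewrite /C; case: ifP.
- rewrite cat_uniq u1 u2 andbT /=; apply/hasPn => j j2.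
  by apply/negP => j1; exact: (dis j).
rewrite big_cat/=; congr (_ * _)%E; rewrite !big_seq; apply: eq_bigr => j jJ.
  by rewrite /C jJ.
by rewrite E2.
Qed.

Lemma cylindersT A : cylinders A setT.
Proof.
exists [::], (fun=> setT); split => //.
by apply/seteqP; split.
Qed.

Lemma info_indep (A B : set I) (U : set (info A)) (V : set (info B)) :
  A `&` B = set0 -> measurable U -> measurable V ->
  P ((U : set T) `&` (V : set T)) = (P U * P V)%E.
Proof.
move=> AB mU mV.
have fin W : measurable W -> P W \is a fin_num by move=> mW; exact: fin_num_measure.
(* For fixed [W], the maps Z to P(Z [&] W) and Z to P Z * P W are finite measures; agreeing on a
   pi-system containing [setT], they agree on the sigma-algebra it generates. It is used twice, once
   for each of the two events. *)
have extend (G : set (set T)) (W : set T) : measurable W -> G `<=` measurable ->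
    setI_closed G -> G setT ->
    (forall Z, G Z -> P (Z `&` W) = (P Z * P W)%E) ->
    forall Z, <<s G >> Z -> P (Z `&` W) = (P Z * P W)%E.
  move=> mW Gm GI GT GW Z GZ.
  have PW0 : 0 <= fine (P W) by exact: fine_ge0.
  rewrite -(fineK (fin _ mW)) muleC.
  apply: (@g_sigma_algebra_measure_unique _ R T G Gm (fun=> setT) _ _
    (mrestr P mW) (mscale (NngNum PW0) P)) => //=.
  - by rewrite bigcup_const.
  - move=> Y GY; rewrite /mrestr/= /mscale/= fineK ?fin// GW// muleC//.
  - by move=> _; rewrite /mrestr setTI; rewrite ltey_eq fin.
have step1 W : cylinders B W -> P ((U : set T) `&` W) = (P U * P W)%E.
  move=> BW; apply: (extend (cylinders A)) => //.
  - exact: measurable_cylinders BW.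
  - exact: measurable_cylinders.
  - exact: cylinders_setI.
  - exact: cylindersT.
  - by move=> Z AZ; exact: (cylinder_indep AB AZ BW).
rewrite setIC muleC; apply: (extend (cylinders B)) => //.
- exact: info_measurable.
- exact: measurable_cylinders.
- exact: cylinders_setI.
- exact: cylindersT.
- by move=> Z BZ; rewrite setIC muleC step1.
Qed.

End independence.

(** * Fubini and Tonelli for a pair of independent maps *)

Section decoupling.
Context (d d1 d2 : measure_display) (T : measurableType d)
  (S1 : measurableType d1) (S2 : measurableType d2) (R : realType).
Context (P : probability T R) (Y : T -> S1) (Z : T -> S2).
Hypothesis mY : measurable_fun setT Y.
Hypothesis mZ : measurable_fun setT Z.
Hypothesis YZ : forall A B, measurable A -> measurable B ->
  P (Y @^-1` A `&` Z @^-1` B) = (P (Y @^-1` A) * P (Z @^-1` B))%E.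

HB.instance Definition _ := isMeasurableFun.Build _ _ _ _ Y mY.
HB.instance Definition _ := isMeasurableFun.Build _ _ _ _ Z mZ.

Let PY : probability S1 R := distribution P Y.
Let PZ : probability S2 R := distribution P Z.
Let YxZ (w : T) := (Y w, Z w).
Let mYxZ : measurable_fun setT YxZ.
Proof. exact: measurable_fun_pair. Qed.
HB.instance Definition _ := isMeasurableFun.Build _ _ _ _ YxZ mYxZ.
Let PYZ : probability (S1 * S2)%type R := distribution P YxZ.

Let joint_law (U : set (S1 * S2)) : measurable U -> (PY \x PZ)%E U = PYZ U.
Proof.
apply: product_measure_unique => A B mA mB.
by rewrite /PYZ /PY /PZ /distribution /= /pushforward /= -YZ.
Qed.

Lemma ge0_decouple (F : S1 * S2 -> \bar R) :
  measurable_fun setT F -> (forall x, 0 <= F x)%E ->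
  (\int[P]_w F (Y w, Z w) = \int[P]_w \int[P]_w' F (Y w, Z w'))%E.
Proof.
move=> mF F0.
transitivity (\int[PYZ]_x F x)%E; first by rewrite ge0_integral_distribution.
transitivity (\int[PY \x PZ]_x F x)%E.
  by apply: eq_measure_integral => U mU _; apply/esym; exact: joint_law.
rewrite fubini_tonelli1// ge0_integral_distribution//; first last.
- by move=> y; exact: integral_ge0.
- exact: measurable_fun_fubini_tonelli_F.
apply: eq_integral => w _; rewrite /= /fubini_F ge0_integral_distribution//.
exact: measurableT_comp.
Qed.

Lemma ge0_decouple_measurable (F : S1 * S2 -> \bar R) :
  measurable_fun setT F -> (forall x, 0 <= F x)%E ->
  measurable_fun setT (fun w => \int[P]_w' F (Y w, Z w'))%E.
Proof.
move=> mF F0.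
have -> : (fun w => \int[P]_w' F (Y w, Z w'))%E = fubini_F PZ F \o Y.
  apply/funext => w /=; rewrite /fubini_F ge0_integral_distribution//.
  exact: measurableT_comp.
by apply: measurableT_comp => //; exact: measurable_fun_fubini_tonelli_F.
Qed.

(** Integrability of every section, not just almost every one, identifies [fubini_F PZ F (Y w)] with
    the inner integral at each [w]. *)
Lemma decouple (F : S1 * S2 -> \bar R) :
  measurable_fun setT F ->
  P.-integrable setT (fun w => F (Y w, Z w)) ->
  (forall w, P.-integrable setT (fun w' => F (Y w, Z w'))) ->
  (\int[P]_w F (Y w, Z w) = \int[P]_w \int[P]_w' F (Y w, Z w'))%E.
Proof.
move=> mF iF iF2.
transitivity (\int[PYZ]_x F x)%E; first by rewrite integral_distribution.
have iYZ : PYZ.-integrable setT F by apply: integrable_pushforward.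
have iF' : (PY \x PZ)%E.-integrable setT F.
  apply/integrableP; split => //; have /integrableP[_] := iYZ.
  by congr (_ < _)%E; apply: eq_measure_integral => U mU _; apply/esym; exact: joint_law.
transitivity (\int[PY \x PZ]_x F x)%E.
  by apply: eq_measure_integral => U mU _; apply/esym; exact: joint_law.
rewrite -integral12_prod_meas1//.
have E w : fubini_F PZ F (Y w) = (\int[P]_w' F (Y w, Z w'))%E.
  have mFY : measurable_fun setT (fun z => F (Y w, z)).
    exact: measurableT_comp.
  by rewrite /fubini_F integral_distribution//; exact: iF2.
rewrite integral_distribution//.
- by apply: eq_integral => w _; rewrite /= E.
- exact: measurable_int (integrable_fubini_F iF').
- have /integrableP[mFF FF] := integrable_fubini_F iF'.
  apply/integrableP; split; first exact: measurableT_comp.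
  by move: FF; rewrite ge0_integral_distribution//; exact: measurableT_comp.
Qed.

End decoupling.

(** * Calculus of integrable variables with a given mean *)

Section mean.
Context (d : measure_display) (T : measurableType d) (R : realType).
Context (P : probability T R).
Implicit Types (X Y : T -> R) (a b c : R).

(** Bundling integrability with the value lets the mean of a polynomial in several variables be
    assembled as a single term from the closure lemmas below. *)
Definition has_mean X c :=
  P.-integrable setT (EFin \o X) /\ (\int[P]_w (X w)%:E = c%:E)%E.

Lemma has_mean_ext X Y c : X =1 Y -> has_mean X c -> has_mean Y c.
Proof. by move=> /funext ->. Qed.

Lemma has_mean_cst c : has_mean (fun=> c) c.
Proof.
split; first by apply: finite_measure_integrable_cst.
by rewrite integral_cst//= probability_setT mule1.
Qed.

Lemma has_meanD X Y a b :
  has_mean X a -> has_mean Y b -> has_mean (fun w => X w + Y w) (a + b).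
Proof.
move=> [iX EX] [iY EY]; split.
  exact: (integrableD measurableT iX iY).
under eq_integral do rewrite EFinD.
by rewrite (integralD measurableT iX iY) EX EY.
Qed.

Lemma has_meanZ X a c : has_mean X a -> has_mean (fun w => c * X w) (c * a).
Proof.
move=> [iX EX]; split; first exact: (integrableZl measurableT c iX).
under eq_integral do rewrite EFinM.
by rewrite (integralZl measurableT iX) EX.
Qed.

Lemma has_mean_sum (I : Type) (r : seq I) (Q : pred I) (X : I -> T -> R)
    (c : I -> R) : (forall i, Q i -> has_mean (X i) (c i)) ->
  has_mean (fun w => \sum_(i <- r | Q i) X i w) (\sum_(i <- r | Q i) c i).
Proof.
move=> h; elim: r => [|i r IH].
  rewrite big_nil; apply: has_mean_ext (has_mean_cst 0) => w.
  by rewrite big_nil.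
rewrite big_cons; case: ifPn => Qi.
  by apply: has_mean_ext (has_meanD (h _ Qi) IH) => w; rewrite big_cons Qi.
by apply: has_mean_ext IH => w; rewrite big_cons (negbTE Qi).
Qed.

Lemma has_mean_le X Y a b : has_mean X a -> has_mean Y b ->
  (forall w, X w <= Y w) -> a <= b.
Proof.
move=> [iX EX] [iY EY] XY; rewrite -lee_fin -EX -EY.
by apply: (le_integral measurableT iX iY) => w _; rewrite lee_fin.
Qed.

Lemma has_mean_dominated X Y b : measurable_fun setT X -> has_mean Y b ->
  (forall w, `|X w| <= Y w) -> exists c, has_mean X c.
Proof.
move=> mX [iY EY] XY.
have iX : P.-integrable setT (EFin \o X).
  apply: (le_integrable measurableT _ _ iY); first exact/measurable_EFinP.
  by move=> w _ /=; rewrite lee_fin (le_trans (XY w))// ler_norm.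
exists (fine (\int[P]_w (X w)%:E)%E); split => //.
by rewrite fineK//; exact: integrable_fin_num iX.
Qed.

Lemma has_mean_uniq X a b : has_mean X a -> has_mean X b -> a = b.
Proof. by move=> [_ EX] [_]; rewrite EX => -[]. Qed.

End mean.

(** * Decoupling over disjoint index sets *)

Section independent_mean.
Context (d : measure_display) (T : measurableType d) (R : realType).
Context (P : probability T R) (I : eqType) (X : I -> T -> R).
Hypothesis mX : forall i, measurable_fun setT (X i).
Hypothesis indepX : mutually_independent P X.
Context (A B : set I).
Hypothesis AB : A `&` B = set0.

Let mA := @measurable_to_info _ _ _ _ _ mX A.
Let mB := @measurable_to_info _ _ _ _ _ mX B.
Let indepAB := fun U V => @info_indep _ _ _ _ _ _ mX indepX A B U V AB.

Lemma ge0_info_decouple (F : T -> T -> \bar R) :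
  measurable_fun setT (fun z : info X A * info X B => F z.1 z.2) ->
  (forall w w', 0 <= F w w')%E ->
  (\int[P]_w F w w = \int[P]_w \int[P]_w' F w w')%E.
Proof.
move=> mF F0.
exact: (@ge0_decouple _ _ _ T (info X A) (info X B) R P id id mA mB indepAB _ mF).
Qed.

Lemma ge0_info_decouple_measurable (F : T -> T -> \bar R) :
  measurable_fun setT (fun z : info X A * info X B => F z.1 z.2) ->
  (forall w w', 0 <= F w w')%E ->
  measurable_fun setT (fun w => \int[P]_w' F w w')%E.
Proof.
move=> mF F0.
exact: (@ge0_decouple_measurable _ _ _ T (info X A) (info X B) R P id id mA mB _ mF).
Qed.

Lemma info_decouple (F : T -> T -> \bar R) :
  measurable_fun setT (fun z : info X A * info X B => F z.1 z.2) ->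
  P.-integrable setT (fun w => F w w) ->
  (forall w, P.-integrable setT (F w)) ->
  (\int[P]_w F w w = \int[P]_w \int[P]_w' F w w')%E.
Proof.
move=> mF iF iF2.
exact: (@decouple _ _ _ T (info X A) (info X B) R P id id mA mB indepAB _ mF).
Qed.

Lemma ge0_integral_indepM (Y Z : T -> R) :
  measurable_fun setT (Y : info X A -> R) ->
  measurable_fun setT (Z : info X B -> R) ->
  (forall w, 0 <= Y w) -> (forall w, 0 <= Z w) ->
  (\int[P]_w (Y w * Z w)%:E = (\int[P]_w (Y w)%:E) * (\int[P]_w (Z w)%:E))%E.
Proof.
move=> mY mZ Y0 Z0.
have mYT : measurable_fun setT (EFin \o Y).
  by apply/measurable_EFinP; exact: (info_fun mX mY).
have mZT : measurable_fun setT (EFin \o Z).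
  by apply/measurable_EFinP; exact: (info_fun mX mZ).
rewrite (ge0_info_decouple (F := fun w w' => (Y w * Z w')%:E)).
- have inner w : (\int[P]_w' (Y w * Z w')%:E = (Y w)%:E * \int[P]_w' (Z w')%:E)%E.
    under eq_integral do rewrite EFinM.
    by rewrite ge0_integralZl//; [move=> w' _|]; rewrite lee_fin.
  under eq_integral do rewrite inner.
  rewrite ge0_integralZr//; first by move=> w _; rewrite lee_fin.
  by apply: integral_ge0 => w _; rewrite lee_fin.
- apply/measurable_EFinP; apply: measurable_funM.
    exact: (measurableT_comp mY (measurable_fst)).
  exact: (measurableT_comp mZ (measurable_snd)).
- by move=> w w'; rewrite lee_fin mulr_ge0.
Qed.

Lemma has_meanM (Y Z : T -> R) (a b : R) :
  measurable_fun setT (Y : info X A -> R) ->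
  measurable_fun setT (Z : info X B -> R) ->
  has_mean P Y a -> has_mean P Z b -> has_mean P (fun w => Y w * Z w) (a * b).
Proof.
move=> mY mZ [iY EY] [iZ EZ].
have mYZ : measurable_fun setT
    (fun z : info X A * info X B => (Y z.1 * Z z.2)%:E).
  apply/measurable_EFinP; apply: measurable_funM.
    exact: (measurableT_comp mY (measurable_fst)).
  exact: (measurableT_comp mZ (measurable_snd)).
have iYZ : P.-integrable setT (fun w => (Y w * Z w)%:E).
  apply/integrableP; split.
    apply/measurable_EFinP; apply: measurable_funM.
      exact: (info_fun mX mY).
    exact: (info_fun mX mZ).
  (* Integrability of the product comes from Tonelli applied to its absolute value: the integral
     splits into two finite factors. Only then does the signed decoupling apply. *)
  rewrite (ge0_info_decouple (F := fun w w' => `|(Y w * Z w')%:E|%E))//; last first.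
    exact: measurableT_comp.
  under eq_integral => w _.
    under eq_integral => w' _ do rewrite EFinM abseM.
    rewrite ge0_integralZl//; last first.
      by apply: measurableT_comp => //; apply/measurable_EFinP; exact: (info_fun mX mZ).
    over.
  have /integrableP[_ fY] := iY; have /integrableP[_ fZ] := iZ.
  rewrite ge0_integralZr//.
  - by rewrite lte_mul_pinfty//; [exact: integral_ge0|
      rewrite ge0_fin_numE//; exact: integral_ge0].
  - by apply: measurableT_comp => //; apply/measurable_EFinP; exact: (info_fun mX mY).
  - exact: integral_ge0.
split => //.
rewrite (info_decouple (F := fun w w' => (Y w * Z w')%:E))//.
  under eq_integral => w _.
    under eq_integral => w' _ do rewrite EFinM.
    rewrite (integralZl measurableT iZ) EZ.
    over.
  by rewrite (integralZr measurableT iY) EY.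
by move=> w; exact: (integrableZl measurableT (Y w) iZ).
Qed.

End independent_mean.

(** * The standard normal density and integration by parts *)

Section gaussian.
Context (R : realType).
Local Notation mu := (@lebesgue_measure R).
Local Notation phi := (@normal_pdf R 0 1).

Lemma normal_pdf01E x : phi x = normal_peak 1 * expR (- (x ^+ 2 / 2)).
Proof. by rewrite normal_pdfE ?oner_eq0// /normal_fun subr0 expr1n mulNr. Qed.

Lemma is_derive_normal_pdf01 (x : R) : is_derive x 1 phi (- x * phi x).
Proof.
have -> : phi = fun x => normal_peak 1 * expR (- (x ^+ 2 / 2)).
  by apply/funext => y; exact: normal_pdf01E.
apply: is_derive_eq; rewrite /= /GRing.scale/=.
by field.
Qed.

(** Change of variables holds with the Radon-Nikodym derivative, which equals [normal_pdf] almost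
    everywhere because both have the same integral over every measurable set. *)
Lemma ge0_integral_normal_prob (m s : R) (f : R -> \bar R) :
  s != 0 -> measurable_fun setT f -> (forall x, 0 <= f x)%E ->
  (\int[normal_prob m s]_x f x = \int[mu]_x (f x * (normal_pdf m s x)%:E))%E.
Proof.
move=> s0 mf f0.
have dom := normal_prob_dominates m s.
rewrite -(Radon_Nikodym_SigmaFinite.change_of_variables dom)//.
have mRN := measurable_int _ (Radon_Nikodym_SigmaFinite.f_integrable dom).
apply: ae_eq_integral => //.
- exact: emeasurable_funM.
- apply: emeasurable_funM => //; apply/measurable_EFinP.
  exact: measurable_normal_pdf.
- apply: ae_eqe_mul2l; apply: integral_ae_eq => //.
  + exact: Radon_Nikodym_SigmaFinite.f_integrable.
  + by apply/measurable_EFinP; exact: measurable_normal_pdf.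
  + by move=> E _ mE; rewrite -Radon_Nikodym_SigmaFinite.f_integral.
Qed.

Lemma gaussian_integrable (F : R -> R) (K : R) : measurable_fun setT F ->
  (forall x, `|F x| <= K * expR (x ^+ 2 / 4)) ->
  mu.-integrable setT (fun x => (F x * phi x)%:E).
Proof.
(* exp(x^2/4) exp(-x^2/2) = exp(-x^2/4) is, up to a constant, the normal density of variance 2,
   which serves as the integrable majorant. *)
move=> mF FK; pose s : R := Num.sqrt 2.
have s2 : s ^+ 2 = 2 by rewrite sqr_sqrtr.
have s0 : s != 0 by rewrite sqrtr_eq0 -ltNge.
have K0 : 0 <= K.
  by have := FK 0; rewrite expr0n/= mul0r expR0 mulr1; exact: le_trans.
have i2 := integrable_normal_pdf 0 s.
pose c := K * normal_peak 1 / normal_peak s.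
apply: (le_integrable measurableT _ _ (integrableZl measurableT c i2)).
  apply/measurable_EFinP; apply: measurable_funM => //.
  exact: measurable_normal_pdf.
move=> x _ /=; rewrite lee_fin normrM [X in _ * X]ger0_norm ?normal_pdf_ge0//.
apply: le_trans (ler_norm _); rewrite normal_pdf01E normal_pdfE// /normal_fun.
rewrite subr0 s2.
have p0 := normal_peak_gt0 s0.
have -> : c * (normal_peak s * expR (- x ^+ 2 / (2 *+ 2))) =
    K * expR (x ^+ 2 / 4) * (normal_peak 1 * expR (- (x ^+ 2 / 2))).
  have -> : expR (- x ^+ 2 / (2 *+ 2)) = expR (x ^+ 2 / 4) * expR (- (x ^+ 2 / 2)).
    by rewrite -expRD; congr expR; field.
  by rewrite /c; field; rewrite lt0r_neq0.
by rewrite ler_wpM2r// mulr_ge0 ?expR_ge0// normal_peak_ge0.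
Qed.

Lemma abs_le_expR (x : R) : `|x| <= 4 * expR (x ^+ 2 / 8).
Proof.
have := expR_ge1Dx (x ^+ 2 / 8); rewrite -real_normK ?num_real//.
by have := sqr_ge0 (`|x| - 1); nra.
Qed.

(** With y = x^2/8, x^6 = 512 y^3 <= 512 * 6 * exp y, and 1 + x^6 dominates every power below the
    sixth; 4000 exceeds 3072 with room to spare. *)
Lemma expr_le_expR (k : nat) (x : R) : (k < 6)%N ->
  `|x ^+ k| <= 4000 * expR (x ^+ 2 / 8).
Proof.
move=> k6.
have y0 : 0 <= x ^+ 2 / 8 by rewrite divr_ge0// sqr_ge0.
have h1 := expR_ge1Dxn 2 y0.
have e1 : 1 <= expR (x ^+ 2 / 8).
  by rewrite (le_trans _ (expR_ge1Dx _))// lerDl.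
have : `|x ^+ k| <= 1 + (x ^+ 2) ^+ 3.
  rewrite normrX -[x ^+ 2]real_normK ?num_real// -exprM.
  have [x1|x1] := lerP `|x| 1.
    apply: (@le_trans _ _ 1); first exact: exprn_ile1.
    by rewrite lerDl exprn_ge0.
  rewrite (le_trans (ler_weXn2l (ltW x1) (_ : (k <= 6)%N)))//; first exact: ltnW.
  by rewrite lerDr.
move: h1; rewrite !factS fact0 => h1.
rewrite (_ : (x ^+ 2 / 8) ^+ 3 = (x ^+ 2) ^+ 3 / 512) in h1; last by field.
lra.
Qed.

(** The integrand is the derivative of F phi. The fundamental theorem on growing symmetric intervals
    leaves boundary terms that vanish, and dominated convergence passes to the whole line. *)
Lemma gaussian_by_parts (F F' : R -> R) (K : R) :
  (forall x : R, is_derive x 1 F (F' x)) -> continuous F' ->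
  (forall x, `|F x| <= K * expR (x ^+ 2 / 8)) ->
  (forall x, `|F' x| <= K * expR (x ^+ 2 / 8)) ->
  (\int[mu]_x ((F' x - x * F x) * phi x)%:E = 0)%E.
Proof.
move=> dF cF' FK F'K.
have K0 : 0 <= K.
  by have := FK 0; rewrite expr0n/= mul0r expR0 mulr1; exact: le_trans.
have cF : continuous F.
  move=> x; apply/differentiable_continuous/derivable1_diffP.
  by have [] := dF x.
have cphi : continuous phi by exact: continuous_normal_pdf.
pose H x := (F' x - x * F x) * phi x.
have cH : continuous H.
  move=> x; apply: cvgM; last exact: cphi.
  by apply: cvgB; [exact: cF'|apply: cvgM; [exact: cvg_id|exact: cF]].
have mH : measurable_fun setT H by exact: continuous_measurable_fun.
have iH : mu.-integrable setT (EFin \o H).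
  apply: (@gaussian_integrable _ (5 * K)).
    apply: continuous_measurable_fun => x.
    by apply: cvgB; [exact: cF'|apply: cvgM; [exact: cvg_id|exact: cF]].
  move=> x; apply: (le_trans (ler_normB _ _)).
  have e1 : 1 <= expR (x ^+ 2 / 8).
    by rewrite -expR0 ler_expR divr_ge0// sqr_ge0.
  have -> : x ^+ 2 / 4 = x ^+ 2 / 8 + x ^+ 2 / 8 by lra.
  rewrite expRD normrM; have := F'K x; have := FK x; have := abs_le_expR x.
  move: (expR _) e1 => e e1 xe Fe F'e.
  have : `|x| * `|F x| <= (4 * e) * (K * e) by apply: ler_pM.
  have : K * e <= K * e * e by rewrite ler_peMr// mulr_ge0//; lra.
  nra.
pose G x := F x * phi x.
have dG (x : R) : is_derive x 1 G (H x).
  have := is_derive_normal_pdf01 x; have := dF x => ? ?.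
  apply: is_derive_eq; rewrite /H /GRing.scale/=; ring.
pose D (n : nat) : set R := [set` `[(- n.+1%:R : R), n.+1%:R]%R].
have FTC (n : nat) : (\int[mu]_(x in D n) (H x)%:E =
    (G n.+1%:R - G (- n.+1%:R))%R%:E)%E.
  rewrite (@continuous_FTC2 _ H G).
  - by rewrite EFinB.
  - by rewrite gtrN.
  - exact: continuous_subspaceT.
  - have cG : continuous G.
      move=> x; apply/differentiable_continuous/derivable1_diffP.
      by have [] := dG x.
    split.
    + by move=> x _; have [] := dG x.
    + by apply: cvg_at_right_filter; exact: cG.
    + by apply: cvg_at_left_filter; exact: cG.
  - by move=> x _; rewrite derive1E; apply: derive_val.
(* The sign [s] treats both endpoints at once. Completing the square gives m^2/8 - m^2/2 <= 2/3 - m,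
   hence the factor exp(2/3) and the decay exp(-m). *)
have Gto0 (s : R) : s ^+ 2 = 1 -> G (s * n.+1%:R) @[n --> \oo] --> (0 : R).
  move=> s1.
  apply/norm_cvg0P.
  pose c := K * normal_peak 1 * expR (2 / 3).
  apply: (@squeeze_cvgr _ _ _ _ (fun=> 0) (fun n : nat => c * expR (- n.+1%:R))).
  - apply: nearW => n; rewrite normr_ge0/= /G normrM.
    rewrite [X in _ * X]ger0_norm ?normal_pdf_ge0// normal_pdf01E.
    apply: (@le_trans _ _ (K * expR ((s * n.+1%:R) ^+ 2 / 8) *
      (normal_peak 1 * expR (- ((s * n.+1%:R) ^+ 2 / 2))))).
      by rewrite ler_wpM2r// mulr_ge0 ?expR_ge0// normal_peak_ge0.
    rewrite mulrACA -expRD /c -[leRHS]mulrA -expRD.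
    rewrite ler_wpM2l ?mulr_ge0 ?normal_peak_ge0// ler_expR exprMn s1 mul1r.
    by have := sqr_ge0 (n.+1%:R - 4 / 3 : R); lra.
  - exact: cvg_cst.
  - rewrite -[X in _ --> X](mulr0 c); apply: cvgM; first exact: cvg_cst.
    by have := @cvgn_expR R; rewrite -cvg_shiftS.
pose f_ (n : nat) := (EFin \o H) \_ (D n).
have [_ _ lim] : [/\ mu.-integrable setT (EFin \o H),
  [sequence \int[mu]_x `|f_ n x - (EFin \o H) x|]_n @ \oo --> 0%E &
  [sequence \int[mu]_x (f_ n x)]_n @ \oo --> \int[mu]_x (EFin \o H) x]%E.
  apply: (@dominated_convergence _ _ _ mu setT measurableT f_ _ (abse \o (EFin \o H))).
  - move=> n; apply/(measurable_restrictT _ _).1.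
      exact: measurable_itv.
    by apply: measurable_funTS; exact/measurable_EFinP.
  - exact/measurable_EFinP.
  - apply: aeW => x _; apply: cvg_near_cst.
    exists (Num.truncn `|x|).+1 => // n /= xn.
    have xD : D n x.
      rewrite /D/= in_itv/= -ler_norml ltW//.
      by rewrite (lt_le_trans (truncnS_gt _))// ler_nat (leq_trans xn).
    by rewrite /f_ patchE mem_set.
  - exact: integrable_abse.
  - apply: aeW => x n _; rewrite /f_ patchE; case: ifP => //= _.
    by rewrite normr0 lee_fin.
have : [sequence \int[mu]_x (f_ n x)]_n%E @ \oo --> 0%E.
  have -> : [sequence \int[mu]_x (f_ n x)]_n%E =
      EFin \o (fun n => G (1 * n.+1%:R) - G (-1 * n.+1%:R)).
    apply/funext => n /=; rewrite /f_ -integral_mkcond FTC.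
    by rewrite mul1r mulN1r.
  apply: cvg_EFin; first exact: nearW.
  rewrite -[X in _ --> X](subr0 0); apply: cvgB; apply: Gto0.
    by rewrite expr1n.
  by rewrite sqrrN expr1n.
by move=> /(cvg_unique _ lim) => /(_ _) <-.
Qed.

End gaussian.

(** * Stein's identity and moments of a standard normal variable *)

Section standard_gaussian.
Context (d : measure_display) (T : measurableType d) (R : realType).
Context (P : probability T R) (Z : T -> R).
Hypothesis mZ : measurable_fun setT Z.
Hypothesis lawZ : forall B, measurable B -> P (Z @^-1` B) = normal_prob 0 1 B.
Local Notation mu := (@lebesgue_measure R).
Local Notation phi := (@normal_pdf R 0 1).

Let Z' : T -> measurableTypeR R := Z.
Let mZ' : measurable_fun setT Z'. Proof. exact: mZ. Qed.
HB.instance Definition _ := isMeasurableFun.Build _ _ _ _ Z' mZ'.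

Let maxrMl (a c : R) : 0 <= c -> Num.max a 0 * c = Num.max (a * c) 0.
Proof.
move=> c0; have [a0|/ltW a0] := leP 0 a.
  by rewrite max_l// mulr_ge0.
by rewrite mul0r max_r// mulr_le0_ge0.
Qed.

Let ge0_gaussian_law (F : R -> \bar R) :
  measurable_fun setT F -> (forall x, 0 <= F x)%E ->
  (\int[P]_w F (Z w) = \int[mu]_x (F x * (phi x)%:E))%E.
Proof.
move=> mF F0; rewrite -ge0_integral_normal_prob ?oner_eq0//.
transitivity (\int[distribution P Z']_x F x)%E.
  by rewrite ge0_integral_distribution.
by apply: eq_measure_integral => U mU _; exact: lawZ.
Qed.

Lemma gaussian_law (F : R -> R) (K : R) : measurable_fun setT F ->
  (forall x, `|F x| <= K * expR (x ^+ 2 / 4)) ->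
  has_mean P (fun w => F (Z w)) (fine (\int[mu]_x (F x * phi x)%:E)%E).
Proof.
move=> mF FK; have iF := gaussian_integrable mF FK.
have mF' : measurable_fun setT (EFin \o F) by exact/measurable_EFinP.
split.
  apply/integrableP; split.
    by apply/measurable_EFinP; exact: measurableT_comp.
  rewrite (ge0_gaussian_law (F := abse \o (EFin \o F))); first last.
  - by move=> x; exact: abse_ge0.
  - exact: measurableT_comp.
  - have /integrableP[_] := iF; congr (_ < _)%E; apply: eq_integral => x _ /=.
    by rewrite -EFinM normrM [`|phi x|]ger0_norm ?normal_pdf_ge0.
rewrite fineK; last exact: integrable_fin_num iF.
rewrite integralE [in RHS]integralE; congr (_ - _)%E.
  have := ge0_gaussian_law (measurable_funepos mF') (fun x => funepos_ge0 _ x).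
  move=> E; transitivity (\int[P]_w ((EFin \o F)^\+%E (Z w)))%E.
    by apply: eq_integral => w _; rewrite !funeposE.
  rewrite E; apply: eq_integral => x _.
  by rewrite !funeposE/= -!EFin_max -EFinM maxrMl ?normal_pdf_ge0//.
have := ge0_gaussian_law (measurable_funeneg mF') (fun x => funeneg_ge0 _ x).
move=> E; transitivity (\int[P]_w ((EFin \o F)^\-%E (Z w)))%E.
  by apply: eq_integral => w _; rewrite !funenegE.
rewrite E; apply: eq_integral => x _.
by rewrite !funenegE/= -!EFin_max -EFinM maxrMl ?normal_pdf_ge0// mulNr.
Qed.

(** Both means are Lebesgue integrals against [phi], and their difference is the vanishing integral
    of [gaussian_by_parts]. *)
Lemma stein (F F' : R -> R) (K : R) :
  (forall x : R, is_derive x 1 F (F' x)) -> continuous F' ->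
  (forall x, `|F x| <= K * expR (x ^+ 2 / 8)) ->
  (forall x, `|F' x| <= K * expR (x ^+ 2 / 8)) ->
  exists c, has_mean P (fun w => F' (Z w)) c /\
            has_mean P (fun w => Z w * F (Z w)) c.
Proof.
move=> dF cF' FK F'K.
have K0 : 0 <= K.
  by have := FK 0; rewrite expr0n/= mul0r expR0 mulr1; exact: le_trans.
have cF : continuous F.
  move=> x; apply/differentiable_continuous/derivable1_diffP.
  by have [] := dF x.
have cG : continuous (fun x : R => x * F x).
  by move=> x; apply: cvgM; [exact: cvg_id|exact: cF].
have h1 : has_mean P (fun w => F' (Z w))
    (fine (\int[mu]_x (F' x * phi x)%:E)%E).
  apply: (gaussian_law (K := K)); first exact: continuous_measurable_fun.
  move=> x; apply: le_trans (F'K x) _; rewrite ler_wpM2l// ler_expR.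
  by have := sqr_ge0 x; lra.
have G4 x : `|x * F x| <= 4 * K * expR (x ^+ 2 / 4).
  have -> : x ^+ 2 / 4 = x ^+ 2 / 8 + x ^+ 2 / 8 by lra.
  rewrite normrM expRD mulrACA.
  by apply: ler_pM => //; exact: abs_le_expR.
have h2 : has_mean P (fun w => Z w * F (Z w))
    (fine (\int[mu]_x ((x * F x) * phi x)%:E)%E).
  apply: (gaussian_law (K := 4 * K)); first exact: continuous_measurable_fun.
  exact: G4.
exists (fine (\int[mu]_x (F' x * phi x)%:E)%E); split => //.
suff <- : fine (\int[mu]_x (x * F x * phi x)%:E)%E =
    fine (\int[mu]_x (F' x * phi x)%:E)%E by [].
have i1 : mu.-integrable setT (fun x => (F' x * phi x)%:E).
  apply: (gaussian_integrable (K := K)); first exact: continuous_measurable_fun.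
  move=> x; apply: le_trans (F'K x) _; rewrite ler_wpM2l// ler_expR.
  by have := sqr_ge0 x; lra.
have i2 : mu.-integrable setT (fun x => (x * F x * phi x)%:E).
  apply: (gaussian_integrable (K := 4 * K)) => //.
  exact: continuous_measurable_fun.
have := gaussian_by_parts dF cF' FK F'K.
under eq_integral do rewrite mulrBl EFinB.
rewrite integralB//.
have := integrable_fin_num measurableT i1.
have := integrable_fin_num measurableT i2.
move: (integral _ _ _) (integral _ _ _) => [a| |] [b| |]//= _ _ [].
by move=> /eqP; rewrite subr_eq0 => /eqP.
Qed.

Lemma gaussian_moment_step (k : nat) : (k < 5)%N ->
  exists c, has_mean P (fun w => Z w ^+ k) c /\
            has_mean P (fun w => Z w ^+ k.+2) (k.+1%:R * c).
Proof.
move=> k5.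
have [c [h1 h2]] : exists c, has_mean P (fun w => k.+1%:R * Z w ^+ k) c /\
    has_mean P (fun w => Z w * Z w ^+ k.+1) c.
  (* Stein's identity for x^(k+1) is the recursion between even, or between odd, moments. The factor
     5 covers the coefficient k+1 of the derivative. *)
  apply: (stein (F := fun x => x ^+ k.+1) (F' := fun x => k.+1%:R * x ^+ k)
    (K := 5 * 4000)).
  - move=> x; have -> : (fun y : R => y ^+ k.+1) = (id ^+ k.+1 : R -> R).
      by apply/funext => y; rewrite exprfctE.
    apply: (is_derive_eq (is_deriveX k.+1 (is_derive_id x (1 : R)))).
    by rewrite /GRing.scale/= mulr1.
  - move=> x; apply: cvgM; first exact: cvg_cst.
    exact: exprn_continuous.
  - move=> x; apply: (le_trans (expr_le_expR x (_ : (k.+1 < 6)%N))) => //.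
    by rewrite ler_wpM2r ?expR_ge0//; lra.
  - move=> x; rewrite normrM -mulrA ler_pM//.
      by rewrite ger0_norm// ler_nat.
    by apply: expr_le_expR; exact: ltnW.
exists (k.+1%:R^-1 * c); split.
  apply: has_mean_ext (has_meanZ k.+1%:R^-1 h1) => w.
  by rewrite mulKf// pnatr_eq0.
by rewrite mulVKf ?pnatr_eq0.
Qed.

Lemma gaussian_moments :
  [/\ has_mean P Z 0, has_mean P (fun w => Z w ^+ 2) 1,
      has_mean P (fun w => Z w ^+ 3) 0, has_mean P (fun w => Z w ^+ 4) 3 &
      has_mean P (fun w => Z w ^+ 6) 15].
Proof.
have h0 : has_mean P (fun w => Z w ^+ 0) 1.
  by apply: has_mean_ext (has_mean_cst P 1) => w; rewrite expr0.
have step k c : (k < 5)%N -> has_mean P (fun w => Z w ^+ k) c ->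
    has_mean P (fun w => Z w ^+ k.+2) (k.+1%:R * c).
  move=> k5 h; have [c' [h' h2]] := gaussian_moment_step k5.
  by rewrite (has_mean_uniq h h').
have h1 : has_mean P Z 0.
  have [c [hc hc']] : exists c, has_mean P (fun w => (0 : R)) c /\
      has_mean P (fun w => Z w * 1) c.
    apply: (stein (F := fun=> 1) (F' := fun=> 0) (K := 1)).
    - by move=> x; exact: cvg_cst.
    - by move=> x; rewrite normr1 mul1r -expR0 ler_expR divr_ge0// sqr_ge0.
    - by move=> x; rewrite normr0 mul1r expR_ge0.
  have c0 := has_mean_uniq hc (has_mean_cst P 0).
  by rewrite -c0; apply: has_mean_ext hc' => w; rewrite mulr1.
have h2 := step 0%N _ isT h0; have h4 := step 2%N _ isT h2.
have h6 := step 4%N _ isT h4.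
have h3 : has_mean P (fun w => Z w ^+ 3) (2 * 0).
  apply: (step 1%N) => //.
by move: h2 h3 h4 h6; rewrite !mulr0 !mulr1 -!natrM.
Qed.

End standard_gaussian.

(** * Inner product and Euclidean norm *)

Section euclidean.
Context (R : realType) (n : nat).
Implicit Types (u v x y : 'rV[R]_n).

Definition dotv u v : R := \sum_(i < n) u ord0 i * v ord0 i.

Lemma dotvC u v : dotv u v = dotv v u.
Proof. by apply: eq_bigr => i _; rewrite mulrC. Qed.

Lemma dotvDl u u' v : dotv (u + u') v = dotv u v + dotv u' v.
Proof. by rewrite /dotv -big_split/=; apply: eq_bigr => i _; rewrite mxE mulrDl. Qed.

Lemma dotvZl a u v : dotv (a *: u) v = a * dotv u v.
Proof. by rewrite /dotv mulr_sumr; apply: eq_bigr => i _; rewrite mxE mulrA. Qed.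

Lemma dotvDr u v v' : dotv u (v + v') = dotv u v + dotv u v'.
Proof. by rewrite dotvC dotvDl !(dotvC u). Qed.

Lemma dotvZr a u v : dotv u (a *: v) = a * dotv u v.
Proof. by rewrite dotvC dotvZl (dotvC u). Qed.

Lemma dotvNl u v : dotv (- u) v = - dotv u v.
Proof. by rewrite -scaleN1r dotvZl mulN1r. Qed.

Lemma dotvNr u v : dotv u (- v) = - dotv u v.
Proof. by rewrite dotvC dotvNl dotvC. Qed.

Lemma dotvv_ge0 v : 0 <= dotv v v.
Proof. by apply: sumr_ge0 => i _; rewrite -expr2 sqr_ge0. Qed.

Lemma dotv_subZ u v a :
  dotv (u - a *: v) (u - a *: v) = dotv u u - 2 * a * dotv v u + a ^+ 2 * dotv v v.
Proof.
rewrite !(dotvDl, dotvDr, dotvNl, dotvNr, dotvZl, dotvZr) (dotvC u v); ring.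
Qed.

Lemma enormE v : enorm v = Num.sqrt (dotv v v).
Proof. by rewrite /enorm /dotv; congr Num.sqrt; apply: eq_bigr => i _; rewrite expr2. Qed.

Lemma enorm_ge0 v : 0 <= enorm v. Proof. exact: sqrtr_ge0. Qed.

Lemma enorm_sqr v : enorm v ^+ 2 = dotv v v.
Proof. by rewrite enormE sqr_sqrtr// dotvv_ge0. Qed.

Lemma enormZ a v : enorm (a *: v) = `|a| * enorm v.
Proof.
by rewrite !enormE dotvZl dotvZr mulrA -expr2 sqrtrM ?sqr_ge0// sqrtr_sqr.
Qed.

(** The squared norm of |v| u - |u| v expands to 2 |u| |v| (|u| |v| - <u, v>); dividing by |u| |v|
    requires treating zero norms apart. *)
Lemma cauchy_schwarz u v : dotv u v <= enorm u * enorm v.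
Proof.
have := dotvv_ge0 (enorm v *: u - enorm u *: v).
rewrite !(dotvDl, dotvDr, dotvNl, dotvNr, dotvZl, dotvZr) (dotvC v u).
rewrite -!enorm_sqr; move: (enorm_ge0 u) (enorm_ge0 v).
have zero w w' : enorm w = 0 -> dotv w w' = 0.
  move=> /(congr1 (fun z => z ^+ 2)); rewrite enorm_sqr expr0n/=.
  rewrite /dotv => /eqP; rewrite psumr_eq0; last first.
    by move=> i _; rewrite -expr2 sqr_ge0.
  move=> /allP w0; apply: big1 => i _.
  have := w0 i; rewrite mem_index_enum => /(_ isT)/=.
  by rewrite -expr2 sqrf_eq0 => /eqP ->; rewrite mul0r.
have [/eqP u0|u0] := boolP (enorm u == 0); first by move=> *; rewrite zero// u0 mul0r.
have [/eqP v0|v0] := boolP (enorm v == 0).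
  by move=> *; rewrite dotvC zero// v0 mulr0.
move=> eu ev h.
have uv : 0 < enorm u * enorm v by rewrite mulr_gt0 ?lt0r ?u0 ?v0.
rewrite -(ler_pM2l uv); nra.
Qed.

Lemma abs_dotv_le u v : `|dotv u v| <= enorm u * enorm v.
Proof.
rewrite ler_norml cauchy_schwarz andbT lerNl -dotvNl.
by rewrite (le_trans (cauchy_schwarz _ _))// -scaleN1r enormZ normrN1 mul1r.
Qed.

Lemma coord_le_enorm v i : `|v ord0 i| <= enorm v.
Proof.
rewrite -sqrtr_sqr ler_wsqrtr// (bigD1 i)//= lerDl.
by apply: sumr_ge0 => j _; rewrite sqr_ge0.
Qed.

Lemma enorm_delta i : enorm (delta_mx ord0 i : 'rV[R]_n) = 1.
Proof.
rewrite /enorm (bigD1 i)//= mxE !eqxx/= expr1n big1 ?addr0 ?sqrtr1// => j ji.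
by rewrite mxE (negbTE ji) andbF expr0n.
Qed.

Lemma dotv_delta u i : dotv u (delta_mx ord0 i) = u ord0 i.
Proof.
rewrite /dotv (bigD1 i)//= mxE !eqxx/= mulr1 big1 ?addr0// => j ji.
by rewrite mxE (negbTE ji) andbF mulr0.
Qed.

End euclidean.

(** * Measurability of Lipschitz functions and of one noisy step *)

Section measurability.
Context (d : measure_display) (S : measurableType d) (R : realType) (n : nat).

Lemma measurable_fun_inv (F : S -> R) :
  measurable_fun setT F -> measurable_fun setT (fun s => (F s)^-1).
Proof.
move=> mF.
(* The inverse is rewritten through the measurable power function; the leading factor [F s] makes
   both sides 0 where [F s = 0]. *)
have -> : (fun s => (F s)^-1) = (fun s => F s * (`|F s| `^ (-1)) ^+ 2).
  apply/funext => s; rewrite powR_inv1// exprVn.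
  rewrite real_normK ?num_real//.
  have [->|F0] := eqVneq (F s) 0; first by rewrite invr0 mul0r.
  by field.
apply: measurable_funM => //; apply: measurable_funX.
apply: (@measurableT_comp _ _ _ _ _ _ (fun x : R => x `^ (-1)) _
  (fun s => `|F s|)); first exact: measurable_powR.
exact: measurableT_comp.
Qed.

Lemma measurable_fun_sqrt (F : S -> R) :
  measurable_fun setT F -> measurable_fun setT (fun s => Num.sqrt (F s)).
Proof.
move=> mF; apply: (measurableT_comp _ mF).
by apply: continuous_measurable_fun; exact: sqrt_continuous.
Qed.

Lemma measurable_enorm (X : S -> 'rV[R]_n) :
  (forall i, measurable_fun setT (fun s => X s ord0 i)) ->
  measurable_fun setT (fun s => enorm (X s)).
Proof.
move=> mX; apply: measurable_fun_sqrt; apply: measurable_sum => i.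
exact: measurable_funX.
Qed.

(* F x is the infimum of F q + L * enorm (x - q) over rational points q. *)
Lemma measurable_lipschitz (F : 'rV[R]_n -> R) (L : R) (X : S -> 'rV[R]_n) :
  (forall x y, `|F x - F y| <= L * enorm (x - y)) ->
  (forall i, measurable_fun setT (fun s => X s ord0 i)) ->
  measurable_fun setT (fun s => F (X s)).
Proof.
move=> FL mX.
(* Enumerates the rational points through codes of finite functions; an integer that codes nothing
   is sent to the origin, again a rational point. *)
pose q (k : nat) : 'rV[R]_n :=
  \row_i ratr (odflt [ffun=> 0] (unpickle k : option {ffun 'I_n -> rat}) i).
pose h k s := F (q k) + L * enorm (X s - q k).
have lb s k : F (X s) <= h k s.
  have := FL (X s) (q k); rewrite ler_norml => /andP[_].
  by rewrite lerBlDl.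
have <- : (fun s => infs (h^~ s) 0) = (fun s => F (X s)).
  apply/funext => s; apply/eqP; rewrite eq_le; apply/andP; split; last first.
    apply: lb_le_inf; first by exists (h 0%N s); exists 0%N.
    by move=> _ [k _ <-]; exact: lb.
  (* The Lipschitz error occurs twice, in F at the rational point and in the added penalty, so each
     gets e/2 = M r. Coordinates within r/(n+1) suffice because n <= (n+1)^2; [M] is positive
     whatever the sign of [L]. *)
  apply/ler_addgt0Pr => e e0.
  pose M : R := `|L| + 1.
  have M0 : 0 < M by rewrite ltr_wpDl.
  pose r : R := e / (2 * M).
  have r0 : 0 < r by rewrite divr_gt0// mulr_gt0.
  pose dl : R := r / n.+1%:R.
  have dl0 : 0 < dl by rewrite divr_gt0.
  have /choice[p pP] (i : 'I_n) : exists p : rat, `|X s ord0 i - ratr p| <= dl.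
    have [|p] := @rat_in_itvoo R (X s ord0 i - dl) (X s ord0 i + dl).
      by lra.
    rewrite in_itv/= => /andP[p1 p2]; exists p.
    by rewrite ler_norml; lra.
  pose k := pickle [ffun i => p i].
  have qk i : q k ord0 i = ratr (p i) by rewrite mxE pickleK/= ffunE.
  have near : enorm (X s - q k) <= r.
    have -> : r = Num.sqrt (r ^+ 2) by rewrite sqrtr_sqr ger0_norm// ltW.
    rewrite ler_wsqrtr//.
    apply: (@le_trans _ _ (\sum_(i < n) dl ^+ 2)).
      apply: ler_sum => i _; rewrite !mxE -/(q k ord0 i).
      rewrite -[leLHS]real_normK ?num_real//.
      have := pP i; rewrite -qk mxE => pi.
      by rewrite lerXn2r// nnegrE ltW.
    rewrite sumr_const card_ord -mulr_natl /dl expr_div_n.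
    rewrite mulrA ler_pdivrMr ?exprn_gt0// mulrC ler_wpM2l ?sqr_ge0//.
    by rewrite -natrX ler_nat expnS expn1 mulSn mulnS; lia.
  apply: (@le_trans _ _ (h k s)).
    apply: ge_inf; last by exists k.
    by exists (F (X s)) => _ [j _ <-]; exact: lb.
  rewrite /h; have := FL (X s) (q k); rewrite ler_norml => /andP[+ _].
  have : L * enorm (X s - q k) <= M * r.
    apply: (@le_trans _ _ (M * enorm (X s - q k))).
      rewrite ler_wpM2r ?enorm_ge0// /M (le_trans (ler_norm _))//.
      by rewrite lerDl.
    by rewrite ler_wpM2l// ltW.
  have -> : M * r = e / 2 by rewrite /r; field; rewrite lt0r_neq0.
  lra.
apply: measurable_fun_infs => [s _|k].
  by exists (F (X s)) => _ [j _ <-]; exact: lb.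
apply: measurable_funD => //; apply: measurable_funM => //.
apply: measurable_enorm => i.
have -> : (fun s => (X s - q k) ord0 i) = (fun s => X s ord0 i - q k ord0 i).
  by apply/funext => s; rewrite !mxE.
exact: measurable_funB.
Qed.

(** Point, direction, radius and noises are kept as unrelated maps on [S], so the lemma serves the
    iterates themselves as well as their decoupled versions on product spaces. *)
Lemma measurable_noisy_step (f : 'rV[R]_n -> R) (L h : R) (Y V : S -> 'rV[R]_n)
    (t a1 a2 : S -> R) (i : 'I_n) :
  (forall x y, `|f x - f y| <= L * enorm (x - y)) ->
  (forall i, measurable_fun setT (fun s => Y s ord0 i)) ->
  (forall i, measurable_fun setT (fun s => V s ord0 i)) ->
  measurable_fun setT t -> measurable_fun setT a1 -> measurable_fun setT a2 ->
  measurable_fun setT (fun s => (Y s - (h *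
    ((noisy f (Y s + t s *: V s) (a1 s) - noisy f (Y s) (a2 s)) / t s)) *: V s)
    ord0 i).
Proof.
move=> fL mY mV mt m1 m2.
have -> : (fun s => (Y s - (h *
    ((noisy f (Y s + t s *: V s) (a1 s) - noisy f (Y s) (a2 s)) / t s)) *: V s)
    ord0 i) = (fun s => Y s ord0 i - h *
      ((f (Y s + t s *: V s) * (1 + a1 s) - f (Y s) * (1 + a2 s)) * (t s)^-1) *
      V s ord0 i).
  by apply/funext => s; rewrite !mxE.
apply: measurable_funB => //; apply: measurable_funM => //.
apply: measurable_funM => //; apply: measurable_funM; last exact: measurable_fun_inv.
apply: measurable_funB; apply: measurable_funM.
- apply: (measurable_lipschitz fL) => j.
  have -> : (fun s => (Y s + t s *: V s) ord0 j) =
      (fun s => Y s ord0 j + t s * V s ord0 j).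
    by apply/funext => s; rewrite !mxE.
  by apply: measurable_funD => //; exact: measurable_funM.
- exact: measurable_funD.
- exact: (measurable_lipschitz fL).
- exact: measurable_funD.
Qed.

End measurability.

(** * First-order inequalities for smooth convex functions *)

Section smooth_convex.
Context (R : realType) (n : nat) (f : 'rV[R]_n -> R) (L1 : R).
Hypothesis df : forall x, differentiable f x.
Hypothesis L1_gt0 : 0 < L1.
Hypothesis gradL : forall x y, enorm (grad f x - grad f y) <= L1 * enorm (x - y).
Implicit Types (x y u v : 'rV[R]_n).

Lemma derive_grad x v : 'D_v f x = dotv (grad f x) v.
Proof.
rewrite deriveE// [in LHS](row_sum_delta v) linear_sum/=.
apply: eq_bigr => i _; rewrite linearZ/= mxE deriveE//.
by rewrite /GRing.scale/= mulrC.
Qed.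

Lemma is_derive_line x v (t : R) :
  is_derive t 1 (fun t => f (x + t *: v)) (dotv (grad f (x + t *: v)) v).
Proof.
have E : (fun h : R => h^-1 *: (((fun t => f (x + t *: v)) \o shift t) (h *: 1)
      - f (x + t *: v))) =
    (fun h : R => h^-1 *: ((f \o shift (x + t *: v)) (h *: v) - f (x + t *: v))).
  apply/funext => h /=; congr (_ *: (f _ - _)).
  have -> : h%:A = h :> R by rewrite /GRing.scale/= mulr1.
  by rewrite scalerDl addrCA.
have D : derivable f (x + t *: v) v by exact: diff_derivable.
split; first by rewrite /derivable E.
by rewrite -derive_grad /derive E.
Qed.

Lemma line_mvt x v : exists2 c : R, 0 <= c <= 1 &
  f (x + v) - f x = dotv (grad f (x + c *: v)) v.
Proof.
have cont : continuous (fun t : R => f (x + t *: v)).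
  move=> t; apply/differentiable_continuous/derivable1_diffP.
  by have [] := is_derive_line x v t.
have [c] := @MVT_segment R (fun t => f (x + t *: v))
  (fun t => dotv (grad f (x + t *: v)) v) 0 1 ler01
  (fun t _ => is_derive_line x v t) (continuous_subspaceT cont).
rewrite in_itv/= => c01; rewrite scale1r scale0r addr0 subr0 mulr1 => E.
by exists c.
Qed.

Lemma descent x v :
  f (x + v) <= f x + dotv (grad f x) v + L1 / 2 * dotv v v.
Proof.
(* Subtracting the quadratic model reduces the claim to p(1) <= p(0); the Lipschitz gradient makes
   the derivative of [p] nonpositive on [0, 1], so the mean value theorem replaces an integral
   remainder. *)
pose p (t : R) := f (x + t *: v) - (t * dotv (grad f x) v + L1 / 2 * t ^+ 2 * dotv v v).
pose p' (t : R) := dotv (grad f (x + t *: v)) v - (dotv (grad f x) v + L1 * t * dotv v v).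
have dp (t : R) : is_derive t 1 p (p' t).
  have ? := is_derive_line x v t.
  apply: is_derive_eq; rewrite /p' /GRing.scale/=.
  by field.
have cp : continuous p.
  move=> t; apply/differentiable_continuous/derivable1_diffP.
  by have [] := dp t.
have [c] := @MVT_segment R p p' 0 1 ler01 (fun t _ => dp t) (continuous_subspaceT cp).
rewrite in_itv/= => /andP[c0 c1]; rewrite subr0 mulr1.
rewrite /p scale1r scale0r addr0 !expr2 !mul0r !mulr0 !mul0r addr0 subr0 !mul1r mulr1 => E.
have : p' c <= 0.
  rewrite /p' opprD addrA subr_le0 -dotvNl -dotvDl.
  apply: (le_trans (cauchy_schwarz _ _)).
  apply: (@le_trans _ _ (L1 * enorm (x + c *: v - x) * enorm v)).
    by rewrite ler_wpM2r ?enorm_ge0.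
  rewrite addrAC subrr add0r enormZ ger0_norm// -!enorm_sqr.
  by rewrite expr2 !mulrA.
rewrite -E; lra.
Qed.

(** A gradient step of length 1/L1 lowers f by at least |grad f|^2 / (2 L1), yet cannot go below the
    minimum. *)
Lemma grad_sqr_le x xs : (forall y, f xs <= f y) ->
  dotv (grad f x) (grad f x) <= 2 * L1 * (f x - f xs).
Proof.
move=> fmin; have := descent x (- L1^-1 *: grad f x).
have := fmin (x + - L1^-1 *: grad f x).
rewrite !(dotvZl, dotvZr); move: (dotv _ _) (f (_ + _)) => g2 a h1 h2.
have : f xs <= f x - g2 / (2 * L1).
  apply: (le_trans h1); apply: (le_trans h2).
  rewrite le_eqVlt; apply/orP; left; apply/eqP.
  by field; rewrite lt0r_neq0.
move=> h3.
have : g2 / (2 * L1) <= f x - f xs by lra.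
by rewrite ler_pdivrMr ?mulr_gt0// [leRHS]mulrC.
Qed.

Lemma convex_grad_le x v : convex_fun f ->
  f x + dotv (grad f x) v <= f (x + v).
Proof.
move=> cvx; apply/ler_addgt0Pr => e e0.
have K0 : 0 <= L1 * dotv v v by rewrite mulr_ge0 ?dotvv_ge0// ltW.
pose K := L1 * dotv v v + 1.
have K1 : 0 < K by rewrite ltr_wpDl.
(* Convexity is used on a short initial piece of the segment, where the gradient moves by so little
   that its error is below [e]; the 1 in [K] keeps it positive when [v] is 0. *)
pose t := Num.min 1 (e / K).
have t0 : 0 < t by rewrite lt_min ltr01 divr_gt0.
have t1 : t <= 1 by rewrite ge_min lexx.
have te : t * K <= e by rewrite -ler_pdivlMr// ge_min lexx orbT.
have := cvx (x + v) x t; rewrite (ltW t0) t1 => /(_ isT).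
have -> : t *: (x + v) + (1 - t) *: x = x + t *: v.
  by rewrite scalerDr addrAC -scalerDl subrKC scale1r.
have [c /andP[c0 c1] E] := line_mvt x (t *: v).
have : dotv (grad f x - grad f (x + c *: (t *: v))) v <= t * (L1 * dotv v v).
  apply: (le_trans (cauchy_schwarz _ _)).
  apply: (@le_trans _ _ (L1 * enorm (x - (x + c *: (t *: v))) * enorm v)).
    by rewrite ler_wpM2r ?enorm_ge0.
  rewrite opprD addrA subrr add0r -scaleNr !enormZ normrN.
  rewrite (ger0_norm c0) (gtr0_norm t0).
  have -> : L1 * (c * (t * enorm v)) * enorm v = c * (t * (L1 * dotv v v)).
    by rewrite -enorm_sqr; ring.
  by rewrite ler_piMl// mulr_ge0// ltW.
rewrite dotvDl dotvNl; move: E; rewrite dotvZr.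
move: (dotv (grad f (x + _)) v) (dotv (grad f x) v) (f (x + t *: v)) => a b F.
move=> E h1 h2.
have : t * (f x + b) <= t * (f (x + v) + e) by rewrite /K in te *; nra.
by rewrite ler_pM2l.
Qed.

End smooth_convex.

Lemma measurable_sum_cond (d : measure_display) (S : measurableType d)
    (R : realType) (J : Type) (r : seq J) (Q : pred J) (F : J -> S -> R) :
  (forall i, Q i -> measurable_fun setT (F i)) ->
  measurable_fun setT (fun s => \sum_(i <- r | Q i) F i s).
Proof.
move=> mF; elim: r => [|i r IH].
  have -> : (fun s => \sum_(i <- [::] | Q i) F i s) = (fun=> 0).
    by apply/funext => s; rewrite big_nil.
  exact: measurable_cst.
have [Qi|Qi] := boolP (Q i).
  have -> : (fun s => \sum_(i <- i :: r | Q i) F i s) =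
      (fun s => F i s + \sum_(i <- r | Q i) F i s).
    by apply/funext => s; rewrite big_cons Qi.
  by apply: measurable_funD => //; exact: mF.
have -> // : (fun s => \sum_(i <- i :: r | Q i) F i s) =
    (fun s => \sum_(i <- r | Q i) F i s).
by apply/funext => s; rewrite big_cons (negbTE Qi).
Qed.

Lemma lipschitz_continuous (R : realType) (G : R -> R) (L : R) :
  (forall x y : R, `|G x - G y| <= L * `|x - y|) -> continuous G.
Proof.
move=> GL x; apply/cvgrPdist_le => e e0; near=> y.
apply: (le_trans (GL x y)).
apply: (@le_trans _ _ ((`|L| + 1) * `|x - y|)).
  by rewrite ler_wpM2r// (le_trans (ler_norm _))// lerDl.
have L0 : 0 < `|L| + 1 by rewrite ltr_wpDl.
rewrite mulrC -ler_pdivlMr//; near: y.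
apply: (@cvgr_dist_le _ _ _ _ _ id x) => //.
by rewrite divr_gt0.
Unshelve. all: by end_near. Qed.

(** * Moments of a standard Gaussian vector *)

Section gaussian_vector.
Context (d : measure_display) (T : measurableType d) (R : realType).
Context (P : probability T R) (I : eqType) (X : I -> T -> R).
Hypothesis mX : forall i, measurable_fun setT (X i).
Hypothesis indepX : mutually_independent P X.
Context (n : nat) (e : 'I_n -> I).
Hypothesis e_inj : injective e.
Hypothesis law : forall i (B : set R), measurable B ->
  P (X (e i) @^-1` B) = normal_prob 0 1 B.

Let u (i : 'I_n) : T -> R := X (e i).
Let U (w : T) : 'rV[R]_n := \row_i u i w.

Let sum_ord_ltS (V : nmodType) (i : 'I_n) (F : 'I_n -> V) :
  \sum_(j < n | (j < i.+1)%N) F j = \sum_(j < n | (j < i)%N) F j + F i.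
Proof.
rewrite (bigD1 i)//= addrC; congr (_ + _); apply: eq_bigl => j.
by rewrite ltnS [RHS]ltn_neqAle andbC.
Qed.

Let before (m : nat) : set I := [set z | exists2 i : 'I_n, (i < m)%N & z = e i].

Let before_disj (i : 'I_n) : before i `&` [set e i] = set0.
Proof.
apply/seteqP; split => // z [[j ji ->]] /= /e_inj ij.
by move: ji; rewrite ij ltnn.
Qed.

Variable c : 'I_n -> R.
Let S m w := \sum_(i < n | (i < m)%N) u i w ^+ 2.
Let L m w := \sum_(i < n | (i < m)%N) c i * u i w.
Let V m := \sum_(i < n | (i < m)%N) c i ^+ 2.

Let mS m : measurable_fun setT (S m : info X (before m) -> R).
Proof.
apply: measurable_sum_cond => i im; apply: measurable_funX.
by apply: measurable_info; exists i.
Qed.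

Let mL m : measurable_fun setT (L m : info X (before m) -> R).
Proof.
apply: measurable_sum_cond => i im; apply: measurable_funM => //.
by apply: measurable_info; exists i.
Qed.

(** Induction on the number of coordinates: [S m] and [L m] depend only on coordinates before m,
    hence are independent of the new one, and each product expands into factors of known mean. The
    means of [L m ^+ 2] and [L m * S m] are carried along only to close the induction for
    [L m ^+ 2 * S m]. *)
Let moments (m : nat) : (m <= n)%N ->
  [/\ has_mean P (S m) m%:R,
      has_mean P (fun w => S m w ^+ 2) (m%:R ^+ 2 + 2 * m%:R),
      has_mean P (fun w => S m w ^+ 3) (m%:R * (m%:R + 2) * (m%:R + 4)) &
  [/\ has_mean P (L m) 0, has_mean P (fun w => L m w ^+ 2) (V m),
      has_mean P (fun w => L m w * S m w) 0 &
      has_mean P (fun w => L m w ^+ 2 * S m w) ((m%:R + 2) * V m)]].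
Proof.
elim: m => [_|m IH mn].
  have S0 w : S 0 w = 0 by rewrite /S big_pred0.
  have L0 w : L 0 w = 0 by rewrite /L big_pred0.
  have V0 : V 0 = 0 by rewrite /V big_pred0.
  have h0 (F : T -> R) c' : F =1 (fun=> 0) -> c' = 0 -> has_mean P F c'.
    by move=> F0 ->; apply: has_mean_ext (has_mean_cst P 0) => w; rewrite F0.
  split; last split; apply: h0; rewrite ?V0 ?mulr0//; move=> *;
    by rewrite ?S0 ?L0 ?expr0n ?mulr0//=; ring.
have [hS hS2 hS3 [hL hL2 hLS hL2S]] := IH (ltnW mn).
pose i := Ordinal mn.
have [h1 h2 h3 h4 h6] := gaussian_moments (mX (e i)) (law i).
have SE w : S m.+1 w = S m w + u i w ^+ 2 by rewrite /S (sum_ord_ltS i).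
have LE w : L m.+1 w = L m w + c i * u i w by rewrite /L (sum_ord_ltS i).
have VE : V m.+1 = V m + c i ^+ 2 by rewrite /V (sum_ord_ltS i).
have mul (Y Z : T -> R) (a b : R) :
    measurable_fun setT (Y : info X (before m) -> R) ->
    measurable_fun setT (Z : info X [set e i] -> R) ->
    has_mean P Y a -> has_mean P Z b -> has_mean P (fun w => Y w * Z w) (a * b).
  exact: (has_meanM mX indepX (before_disj i)).
have mui : measurable_fun setT (u i : info X [set e i] -> R).
  exact: measurable_info.
have muX k : measurable_fun setT ((fun w => u i w ^+ k) : info X [set e i] -> R).
  exact: measurable_funX.
have mSm := @mS m; have mLm := @mL m.
have mS2 : measurable_fun setT ((fun w => S m w ^+ 2) : info X (before m) -> R).
  exact: measurable_funX.
have mL2 : measurable_fun setT ((fun w => L m w ^+ 2) : info X (before m) -> R).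
  exact: measurable_funX.
have mLS : measurable_fun setT ((fun w => L m w * S m w) : info X (before m) -> R).
  exact: measurable_funM.
have natS : m.+1%:R = m%:R + 1 :> R by rewrite natr1.
split; last split.
- rewrite natS; apply: has_mean_ext (has_meanD hS h2) => w; exact/esym/SE.
- have := has_meanD (has_meanD hS2 (has_meanZ 2 (mul _ _ _ _ mSm (muX 2%N) hS h2))) h4.
  rewrite natS; set a := (X in has_mean _ _ X -> _); set b := (X in _ -> has_mean _ _ X).
  have -> : a = b by rewrite /a /b; ring.
  by apply: has_mean_ext => w; rewrite SE /u; ring.
- have := has_meanD (has_meanD (has_meanD hS3
    (has_meanZ 3 (mul _ _ _ _ mS2 (muX 2%N) hS2 h2)))
    (has_meanZ 3 (mul _ _ _ _ mSm (muX 4%N) hS h4))) h6.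
  rewrite natS; set a := (X in has_mean _ _ X -> _); set b := (X in _ -> has_mean _ _ X).
  have -> : a = b by rewrite /a /b; ring.
  by apply: has_mean_ext => w; rewrite SE /u; ring.
- have := has_meanD hL (has_meanZ (c i) h1); rewrite mulr0 addr0.
  by apply: has_mean_ext => w; rewrite LE.
- have := has_meanD (has_meanD hL2 (has_meanZ (2 * c i) (mul _ _ _ _ mLm mui hL h1)))
    (has_meanZ (c i ^+ 2) h2).
  rewrite VE; set a := (X in has_mean _ _ X -> _); set b := (X in _ -> has_mean _ _ X).
  have -> : a = b by rewrite /a /b; ring.
  by apply: has_mean_ext => w; rewrite LE /u; ring.
- have := has_meanD (has_meanD (has_meanD hLS (mul _ _ _ _ mLm (muX 2%N) hL h2))
    (has_meanZ (c i) (mul _ _ _ _ mSm mui hS h1))) (has_meanZ (c i) h3).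
  set a := (X in has_mean _ _ X -> _).
  have -> : a = 0 by rewrite /a; ring.
  by apply: has_mean_ext => w; rewrite LE SE /u; ring.
- have := has_meanD (has_meanD (has_meanD (has_meanD (has_meanD hL2S
    (mul _ _ _ _ mL2 (muX 2%N) hL2 h2))
    (has_meanZ (2 * c i) (mul _ _ _ _ mLS mui hLS h1)))
    (has_meanZ (2 * c i) (mul _ _ _ _ mLm (muX 3%N) hL h3)))
    (has_meanZ (c i ^+ 2) (mul _ _ _ _ mSm (muX 2%N) hS h2)))
    (has_meanZ (c i ^+ 2) h4).
  rewrite natS VE; set a := (X in has_mean _ _ X -> _).
  set b := (X in _ -> has_mean _ _ X).
  have -> : a = b by rewrite /a /b; ring.
  by apply: has_mean_ext => w; rewrite LE SE /u; ring.
Qed.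

Lemma gaussian_vector_moments (v : 'rV[R]_n) : v = \row_i c i ->
  [/\ has_mean P (fun w => dotv (U w) (U w)) n%:R,
      has_mean P (fun w => dotv (U w) (U w) ^+ 2) (n%:R * (n%:R + 2)),
      has_mean P (fun w => dotv (U w) (U w) ^+ 3)
        (n%:R * (n%:R + 2) * (n%:R + 4)),
      has_mean P (fun w => dotv v (U w)) 0 &
      has_mean P (fun w => dotv v (U w) ^+ 2 * dotv (U w) (U w))
        ((n%:R + 2) * dotv v v)].
Proof.
move=> ->; have [hS hS2 hS3 [hL _ _ hL2S]] := moments (leqnn n).
have SE w : S n w = dotv (U w) (U w).
  rewrite /S /dotv; apply: eq_big => [j|j _]; first exact: ltn_ord.
  by rewrite mxE expr2.
have LE w : L n w = dotv (\row_i c i) (U w).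
  rewrite /L /dotv; apply: eq_big => [j|j _]; first exact: ltn_ord.
  by rewrite !mxE.
have VE : V n = dotv (\row_i c i) (\row_i c i).
  rewrite /V /dotv; apply: eq_big => [j|j _]; first exact: ltn_ord.
  by rewrite !mxE expr2.
split.
- by apply: has_mean_ext hS => w; rewrite SE.
- have -> : n%:R * (n%:R + 2) = n%:R ^+ 2 + 2 * n%:R :> R by ring.
  by apply: has_mean_ext hS2 => w; rewrite SE.
- by apply: has_mean_ext hS3 => w; rewrite SE.
- by apply: has_mean_ext hL => w; rewrite LE.
- by rewrite -VE; apply: has_mean_ext hL2S => w; rewrite SE LE.
Qed.

End gaussian_vector.

(** * Gaussian integration by parts for the gradient *)

Section gaussian_gradient.
Context (d : measure_display) (T : measurableType d) (R : realType).
Context (P : probability T R) (I : eqType) (X : I -> T -> R).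
Hypothesis mX : forall i, measurable_fun setT (X i).
Hypothesis indepX : mutually_independent P X.
Context (n : nat) (e : 'I_n -> I).
Hypothesis e_inj : injective e.
Hypothesis law : forall i (B : set R), measurable B ->
  P (X (e i) @^-1` B) = normal_prob 0 1 B.
Context (f : 'rV[R]_n -> R) (L0 L1 : R).
Hypothesis L1_gt0 : 0 < L1.
Hypothesis df : forall x, differentiable f x.
Hypothesis fL : forall x y, `|f x - f y| <= L0 * enorm (x - y).
Hypothesis gradL : forall x y, enorm (grad f x - grad f y) <= L1 * enorm (x - y).

Let u (i : 'I_n) : T -> R := X (e i).
Let U (w : T) : 'rV[R]_n := \row_i u i w.

Lemma dotv_grad_lipschitz v x y :
  `|dotv (grad f x) v - dotv (grad f y) v| <= L1 * enorm v * enorm (x - y).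
Proof.
rewrite -dotvNl -dotvDl (le_trans (abs_dotv_le _ _))//.
by rewrite mulrAC ler_wpM2r ?enorm_ge0.
Qed.

Section one_coordinate.
Variables (x : 'rV[R]_n) (s : R) (i : 'I_n).
Hypothesis s_gt0 : 0 < s.

Let v : 'rV[R]_n := s *: delta_mx ord0 i.
(** Zeroing coordinate i isolates it: x + s U = y + u_i v, where [y] depends only on the other
    coordinates and can be frozen. *)
Let rest w : 'rV[R]_n := \row_j (if j == i then 0 else u j w).
Let y w := x + s *: rest w.

Let v_norm : enorm v = s.
Proof. by rewrite enormZ enorm_delta mulr1 gtr0_norm. Qed.

Let splitU w : x + s *: U w = y w + u i w *: v.
Proof.
apply/rowP => j; rewrite !mxE eqxx/=; case: (eqVneq j i) => [->|_] /=; ring.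
Qed.

Let stein_line w : exists c,
  has_mean P (fun w' => dotv (grad f (y w + u i w' *: v)) v) c /\
  has_mean P (fun w' => u i w' * f (y w + u i w' *: v)) c.
Proof.
(* Gathers the values at [y w] and the slopes along [v] of f and of its directional derivative; each
   slope is weighted by 4 because |z| <= 4 exp(z^2/8). *)
pose K : R := `|f (y w)| + 4 * (`|L0| * s) + `|dotv (grad f (y w)) v| + 4 * (L1 * s * s).
have grow (F : R -> R) (a b : R) : 0 <= a -> 0 <= b -> a + 4 * b <= K ->
    (forall z, `|F z| <= a + b * `|z|) ->
    forall z, `|F z| <= K * expR (z ^+ 2 / 8).
  move=> a0 b0 abK FP z; apply: (le_trans (FP z)).
  apply: (@le_trans _ _ ((a + 4 * b) * expR (z ^+ 2 / 8))); last first.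
    by rewrite ler_wpM2r ?expR_ge0.
  have := abs_le_expR z.
  have e1 : 1 <= expR (z ^+ 2 / 8).
    by rewrite (le_trans _ (expR_ge1Dx _))// lerDl divr_ge0// sqr_ge0.
  move: (expR _) e1 => E E1 zE.
  have : b * `|z| <= b * (4 * E) by rewrite ler_wpM2l.
  have : a <= a * E by rewrite ler_peMr.
  lra.
have K0 := normr_ge0 (f (y w)); have K1 := normr_ge0 (dotv (grad f (y w)) v).
have K2 : 0 <= `|L0| * s by rewrite mulr_ge0// ltW.
have K3 : 0 <= L1 * s * s by rewrite !mulr_ge0// ltW.
apply: (@stein _ _ _ P (u i) (mX (e i)) (@law i)
  (fun z => f (y w + z *: v)) (fun z => dotv (grad f (y w + z *: v)) v) K).
- by move=> z; exact: is_derive_line.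
- apply: (@lipschitz_continuous _ _ (L1 * s * s)) => z z'.
  apply: (le_trans (dotv_grad_lipschitz _ _ _)).
  have -> : y w + z *: v - (y w + z' *: v) = (z - z') *: v.
    by rewrite scalerBl opprD addrACA subrr add0r.
  rewrite (enormZ (z - z')) v_norm.
  by have -> : L1 * s * (`|z - z'| * s) = L1 * s * s * `|z - z'| by ring.
- apply: (@grow _ `|f (y w)| (`|L0| * s)) => //; first by rewrite /K; lra.
  move=> z; have := fL (y w + z *: v) (y w).
  have -> : y w + z *: v - y w = z *: v by rewrite addrC addKr.
  rewrite (enormZ z) v_norm => h.
  have := ler_normD (f (y w + z *: v) - f (y w)) (f (y w)); rewrite subrK.
  have : L0 * (`|z| * s) <= `|L0| * s * `|z|.
    rewrite -mulrA [s * _]mulrC ler_wpM2r ?ler_norm// mulr_ge0// ltW//.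
  lra.
- apply: (@grow _ `|dotv (grad f (y w)) v| (L1 * s * s)) => //.
    by rewrite /K; lra.
  move=> z; have := dotv_grad_lipschitz v (y w + z *: v) (y w).
  have -> : y w + z *: v - y w = z *: v by rewrite addrC addKr.
  rewrite (enormZ z) v_norm => h.
  have := ler_normD (dotv (grad f (y w + z *: v)) v - dotv (grad f (y w)) v)
    (dotv (grad f (y w)) v); rewrite subrK.
  have -> : L1 * s * s * `|z| = L1 * s * (`|z| * s) by ring.
  lra.
Qed.

Let A : set I := [set z | exists2 j, j != i & z = e j].

Let A_disj : A `&` [set e i] = set0.
Proof.
apply/seteqP; split => // z [[j ji ->]] /= /e_inj ij.
by move: ji; rewrite ij eqxx.
Qed.

Let mui : measurable_fun setT (fun z : info X A * info X [set e i] => u i z.2).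
Proof.
have m : measurable_fun setT (u i : info X [set e i] -> R).
  exact: measurable_info.
exact: (measurableT_comp m measurable_snd).
Qed.

Let mline (F : 'rV[R]_n -> R) (L : R) :
  (forall a b, `|F a - F b| <= L * enorm (a - b)) ->
  measurable_fun setT (fun z : info X A * info X [set e i] =>
    F (y z.1 + u i z.2 *: v)).
Proof.
move=> FL; apply: (measurable_lipschitz FL) => j.
have -> : (fun z : info X A * info X [set e i] =>
    (y z.1 + u i z.2 *: v) ord0 j) =
    (fun z => x ord0 j + s * (if j == i then 0 else u j z.1) + u i z.2 * v ord0 j).
  by apply/funext => z; rewrite !mxE.
apply: measurable_funD; last exact: measurable_funM.
apply: measurable_funD => //; apply: measurable_funM => //.
case: (eqVneq j i) => // ji.
have m : measurable_fun setT (u j : info X A -> R).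
  by apply: measurable_info; exists j.
exact: (measurableT_comp m measurable_fst).
Qed.

(** Linear growth of f and of its gradient makes the integrands below at most quadratic in |U|,
    which is integrable. This supplies the diagonal integrability demanded by [info_decouple]. *)
Let Udom (F : T -> R) (K : R) : measurable_fun setT F ->
  (forall w, `|F w| <= K * (1 + enorm (U w) ^+ 2)) -> exists c, has_mean P F c.
Proof.
move=> mF FK.
have [hS _ _ _ _] := gaussian_vector_moments mX indepX e_inj law
  (c := fun=> 0) erefl.
apply: (has_mean_dominated mF (has_meanZ K (has_meanD (has_mean_cst P 1) hS))).
by move=> w; rewrite -enorm_sqr; exact: FK.
Qed.

(** Coordinate i is decoupled from the others, the one-dimensional Stein identity exchanges the
    inner integrals, and the result is recoupled. The factor [s] appears because the line runs in
    the direction s e_i. *)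
Lemma gaussian_partial : exists c,
  has_mean P (fun w => grad f (x + s *: U w) ord0 i) c /\
  has_mean P (fun w => u i w * f (x + s *: U w)) (s * c).
Proof.
have mU j : measurable_fun setT (fun w => (x + s *: U w) ord0 j).
  have -> : (fun w => (x + s *: U w) ord0 j) = (fun w => x ord0 j + s * u j w).
    by apply/funext => w; rewrite !mxE.
  by apply: measurable_funD => //; apply: measurable_funM => //; exact: mX.
have [a ha] : exists a, has_mean P (fun w => dotv (grad f (x + s *: U w)) v) a.
  apply: (@Udom _ (`|dotv (grad f x) v| + L1 * s * s)).
    apply: (measurable_lipschitz (dotv_grad_lipschitz v)); exact: mU.
  move=> w; have := dotv_grad_lipschitz v (x + s *: U w) x.
  rewrite addrAC subrr add0r (enormZ s) v_norm (gtr0_norm s_gt0) => h.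
  have := ler_normD (dotv (grad f (x + s *: U w)) v - dotv (grad f x) v)
    (dotv (grad f x) v); rewrite subrK.
  have := normr_ge0 (dotv (grad f x) v).
  have K3 : 0 <= L1 * s * s by rewrite !mulr_ge0// ltW.
  move: h; rewrite mulrA; move: (L1 * s * s) K3 (`|dotv (grad f x) v|) (enorm (U w)).
  by move=> q q0 b r h b0 h'; have := sqr_ge0 (r - 1); nra.
have [b hb] : exists b, has_mean P (fun w => u i w * f (x + s *: U w)) b.
  apply: (@Udom _ (`|f x| + `|L0| * s)).
    by apply: measurable_funM; [exact: mX|exact: (measurable_lipschitz fL)].
  move=> w; rewrite normrM.
  have uU : `|u i w| <= enorm (U w).
    by have := coord_le_enorm (U w) i; rewrite mxE.
  have := fL (x + s *: U w) x.
  rewrite addrAC subrr add0r (enormZ s) (gtr0_norm s_gt0) => h.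
  have h1 := ler_normD (f (x + s *: U w) - f x) (f x); rewrite subrK in h1.
  have h2 : L0 * (s * enorm (U w)) <= `|L0| * s * enorm (U w).
    by rewrite mulrA ler_wpM2r ?enorm_ge0// ler_wpM2r ?ler_norm// ltW.
  have K3 : 0 <= `|L0| * s by rewrite mulr_ge0// ltW.
  apply: (@le_trans _ _ (enorm (U w) * (`|f x| + `|L0| * s * enorm (U w)))).
    by apply: ler_pM => //; lra.
  have := enorm_ge0 (U w); have := normr_ge0 (f x).
  move: (`|L0| * s) K3 (`|f x|) (enorm (U w)) => q q0 r b1 r0 b0.
  have := sqr_ge0 (b1 - 1); nra.
have E : b = a.
  have [iG EG] := ha; have [iF EF] := hb.
  suff : b%:E = a%:E by case.
  rewrite -EG -EF.
  transitivity (\int[P]_w \int[P]_w' (u i w' * f (y w + u i w' *: v))%:E)%E.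
    rewrite -(info_decouple mX indepX A_disj
      (F := fun w w' => (u i w' * f (y w + u i w' *: v))%:E)).
    - by apply: eq_integral => w _; rewrite splitU.
    - by apply/measurable_EFinP; apply: measurable_funM => //; exact: (mline fL).
    - by move: iF; congr (integrable _ _ _); apply/funext => w /=; rewrite splitU.
    - by move=> w; have [c [_ []]] := stein_line w.
  transitivity (\int[P]_w \int[P]_w' (dotv (grad f (y w + u i w' *: v)) v)%:E)%E.
    apply: eq_integral => w _; have [c [[_ ->] [_ ->]]] := stein_line w.
    by [].
  rewrite -(info_decouple mX indepX A_disj
    (F := fun w w' => (dotv (grad f (y w + u i w' *: v)) v)%:E)).
  - by apply: eq_integral => w _; rewrite splitU.
  - by apply/measurable_EFinP; exact: (mline (dotv_grad_lipschitz v)).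
  - by move: iG; congr (integrable _ _ _); apply/funext => w /=; rewrite splitU.
  - by move=> w; have [c [[]]] := stein_line w.
exists (s^-1 * a); rewrite mulVKf ?lt0r_neq0// -E; split => //.
rewrite E; apply: has_mean_ext (has_meanZ s^-1 ha) => w.
by rewrite dotvZr dotv_delta mulKf// lt0r_neq0.
Qed.

End one_coordinate.

Lemma gaussian_gradient (x D : 'rV[R]_n) (s : R) : 0 < s -> exists c,
  has_mean P (fun w => dotv (grad f (x + s *: U w)) D) c /\
  has_mean P (fun w => dotv (U w) D * f (x + s *: U w)) (s * c).
Proof.
move=> s0.
have /choice[c hc] (i : 'I_n) := gaussian_partial x i s0.
exists (\sum_(i < n) D ord0 i * c i); split.
  have := @has_mean_sum _ _ _ P _ (index_enum 'I_n) xpredT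
    (fun i w => D ord0 i * grad f (x + s *: U w) ord0 i) (fun i => D ord0 i * c i)
    (fun i _ => has_meanZ (D ord0 i) (hc i).1).
  apply: has_mean_ext => w; apply: eq_bigr => i _.
  by rewrite mulrC.
have := @has_mean_sum _ _ _ P _ (index_enum 'I_n) xpredT
  (fun i w => D ord0 i * (u i w * f (x + s *: U w)))
  (fun i => D ord0 i * (s * c i))
  (fun i _ => has_meanZ (D ord0 i) (hc i).2).
have -> : \sum_(i < n) D ord0 i * (s * c i) = s * \sum_(i < n) D ord0 i * c i.
  by rewrite mulr_sumr; apply: eq_bigr => i _; rewrite mulrCA.
apply: has_mean_ext => w; rewrite /dotv mulr_suml; apply: eq_bigr => i _.
by rewrite [U w _ _]mxE; ring.
Qed.

End gaussian_gradient.

(** * Expected squared distance after one step from a fixed point *)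

Section noisy_step.
Context (d : measure_display) (T : measurableType d) (R : realType).
Context (P : probability T R) (I : eqType) (X : I -> T -> R).
Hypothesis mX : forall i, measurable_fun setT (X i).
Hypothesis indepX : mutually_independent P X.
Context (n : nat) (e : 'I_n -> I) (j1 j2 : I).
Hypothesis e_inj : injective e.
Hypothesis j12 : j1 != j2.
Hypothesis ej1 : forall i, e i != j1.
Hypothesis ej2 : forall i, e i != j2.
Hypothesis law : forall i (B : set R), measurable B ->
  P (X (e i) @^-1` B) = normal_prob 0 1 B.
Context (sigr : R).
Hypothesis noise1 : has_mean P (X j1) 0.
Hypothesis noise2 : has_mean P (X j2) 0.
Hypothesis noise1_sqr : has_mean P (fun w => X j1 w ^+ 2) (sigr ^+ 2).
Hypothesis noise2_sqr : has_mean P (fun w => X j2 w ^+ 2) (sigr ^+ 2).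
Context (f : 'rV[R]_n -> R) (L0 L1 : R) (xs : 'rV[R]_n).
Hypothesis L1_gt0 : 0 < L1.
Hypothesis cvxf : convex_fun f.
Hypothesis df : forall x, differentiable f x.
Hypothesis fL : forall x y, `|f x - f y| <= L0 * enorm (x - y).
Hypothesis gradL : forall x y, enorm (grad f x - grad f y) <= L1 * enorm (x - y).
Hypothesis fmin : forall y, f xs <= f y.

Let U (w : T) : 'rV[R]_n := \row_i X (e i) w.
Let N : R := n%:R.

Let noise_product : has_mean P (fun w => X j1 w * X j2 w) 0.
Proof.
rewrite -(mulr0 0).
apply: (has_meanM mX indepX (A := [set j1]) (B := [set j2])) => //.
- apply/seteqP; split => // z [-> /= E]; by move: j12; rewrite E eqxx.
- exact: measurable_info.
- exact: measurable_info.
Qed.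

(** For a fixed direction the squared distance is a quadratic polynomial in the two noises; their
    linear and mixed terms average to 0. *)
Let noise_quadratic (a b r D p q : R) :
  has_mean P (fun w => a - 2 * b * (D + p * X j1 w - q * X j2 w)
                       + r * (D + p * X j1 w - q * X j2 w) ^+ 2)
    (a - 2 * b * D + r * (D ^+ 2 + sigr ^+ 2 * (p ^+ 2 + q ^+ 2))).
Proof.
have := has_meanD (has_meanD (has_meanD (has_meanD (has_meanD
  (has_mean_cst P (a - 2 * b * D + r * D ^+ 2))
  (has_meanZ (- 2 * b * p + 2 * r * D * p) noise1))
  (has_meanZ (2 * b * q - 2 * r * D * q) noise2))
  (has_meanZ (r * p ^+ 2) noise1_sqr))
  (has_meanZ (r * q ^+ 2) noise2_sqr))
  (has_meanZ (- 2 * r * p * q) noise_product).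
set c := (X in has_mean _ _ X -> _); set c' := (X in _ -> has_mean _ _ X).
have -> : c = c' by rewrite /c /c'; ring.
by apply: has_mean_ext => w; ring.
Qed.

Section fixed_point.
Variables (x : 'rV[R]_n) (s h : R).
Hypothesis s_gt0 : 0 < s.
Hypothesis h_ge0 : 0 <= h.

Let D : 'rV[R]_n := x - xs.
Let r w := dotv (U w) (U w).
Let increment w := f (x + s *: U w) - f x.

(** Convexity at x + s U is tested against the shifted minimizer xs + s U; convexity at x and the
    descent lemma at xs then remove the shift, at the price of linear terms of mean 0 and L1 s^2
    |U|^2 / 2. *)
Let mean_descent : exists2 c,
  has_mean P (fun w => dotv (U w) D * f (x + s *: U w)) (s * c) &
  f x - f xs - L1 / 2 * s ^+ 2 * N <= c.
Proof.
have [c [hc hsc]] := gaussian_gradient mX indepX e_inj law L1_gt0 df fL gradL x D s_gt0.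
exists c => //.
have rowE (v : 'rV[R]_n) : v = \row_i v ord0 i by apply/rowP => i; rewrite mxE.
have [hr _ _ hg _] := gaussian_vector_moments mX indepX e_inj law (rowE (grad f x)).
have [_ _ _ hgs _] := gaussian_vector_moments mX indepX e_inj law (rowE (grad f xs)).
have := has_meanD (has_meanD (has_meanD (has_mean_cst P (f x - f xs))
  (has_meanZ s hg)) (has_meanZ (- s) hgs)) (has_meanZ (- (L1 / 2 * s ^+ 2)) hr).
move=> H; have := has_mean_le H hc; set a := (X in (_ -> X <= _) -> _).
have -> : a = f x - f xs - L1 / 2 * s ^+ 2 * N by rewrite /a /N; ring.
apply => w; rewrite -/(U w).
have h1 := convex_grad_le df L1_gt0 gradL (x + s *: U w) (- D) cvxf.
have h2 := convex_grad_le df L1_gt0 gradL x (s *: U w) cvxf.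
have h3 := descent df gradL xs (s *: U w).
have E : x + s *: U w - D = xs + s *: U w.
  by rewrite /D opprB addrCA addrAC subrr add0r addrC.
rewrite E dotvNr in h1; rewrite !(dotvZl, dotvZr) in h2 h3.
lra.
Qed.

Let increment_sqr w : increment w ^+ 2 <=
  s ^+ 2 * (2 * dotv (grad f x) (U w) ^+ 2 + s ^+ 2 * L1 ^+ 2 / 2 * r w ^+ 2).
Proof.
have h2 := convex_grad_le df L1_gt0 gradL x (s *: U w) cvxf.
have h3 := descent df gradL x (s *: U w).
rewrite !(dotvZl, dotvZr) in h2 h3.
rewrite /increment /r; move: (dotv (U w) (U w)) (dotv _ _) h2 h3 => rr g h2 h3.
(* The remainder is nonnegative by convexity, so its upper bound can be squared; then (sg + q)^2 <=
   2 (sg)^2 + 2 q^2. *)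
set q := f (x + s *: U w) - f x - s * g.
have q0 : 0 <= q by rewrite /q; lra.
have q1 : q <= L1 / 2 * (s * (s * rr)) by rewrite /q; lra.
have -> : f (x + s *: U w) - f x = s * g + q by rewrite /q; ring.
have : q ^+ 2 <= (L1 / 2 * (s * (s * rr))) ^+ 2.
  by rewrite lerXn2r// ?nnegrE// (le_trans q0).
have := sqr_ge0 (s * g - q).
have -> : (L1 / 2 * (s * (s * rr))) ^+ 2 =
  s ^+ 2 * (s ^+ 2 * L1 ^+ 2 / 2 * rr ^+ 2) / 2 by field.
rewrite !expr2; lra.
Qed.

Let increment_lip w : increment w ^+ 2 <= L0 ^+ 2 * s ^+ 2 * r w.
Proof.
have := fL (x + s *: U w) x; rewrite addrAC subrr add0r (enormZ s).
rewrite (gtr0_norm s_gt0) => H.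
rewrite /r -enorm_sqr -!exprMn -[leLHS]real_normK ?num_real//.
rewrite mulrA in H.
by rewrite lerXn2r// nnegrE (le_trans _ H).
Qed.

(** With r = |U|^2, the factors N, N(N+2) and N(N+2)(N+4) are the means of r, r^2 and r^3, and (N+2)
    |grad f|^2 is the mean of <grad f, U>^2 r. *)
Definition step_bound : R :=
  dotv D D - 2 * h * (f x - f xs - L1 / 2 * s ^+ 2 * N)
  + h ^+ 2 * (2 * (N + 2) * dotv (grad f x) (grad f x)
              + s ^+ 2 * L1 ^+ 2 / 2 * (N * (N + 2) * (N + 4))
              + sigr ^+ 2 * (4 * f x ^+ 2 / s ^+ 2 * N
                             + 3 / 2 * L0 ^+ 2 * (N * (N + 2)))).

(** The direction is read at [w] and the noises at [w'], so that they can be averaged separately;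
    the diagonal is the actual step. *)
Definition noisy_next (w w' : T) : 'rV[R]_n :=
  x - (h * ((noisy f (x + s *: U w) (X j1 w') - noisy f x (X j2 w')) / s)) *: U w.

Let A : set I := range e.
Let B : set I := [set j1; j2].

Let AB : A `&` B = set0.
Proof.
apply/seteqP; split => // _ [[i _ <-]] /= [E|E].
  by move: (ej1 i); rewrite E eqxx.
by move: (ej2 i); rewrite E eqxx.
Qed.

Let mnext : measurable_fun setT (fun z : info X A * info X B =>
  (enorm (noisy_next z.1 z.2 - xs) ^+ 2)%:E).
Proof.
have mA i : measurable_fun setT (fun z : info X A * info X B => X (e i) z.1).
  have m : measurable_fun setT (X (e i) : info X A -> R).
    by apply: measurable_info; exists i.
  exact: (measurableT_comp m measurable_fst).
have mB j : B j -> measurable_fun setT (fun z : info X A * info X B => X j z.2).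
  move=> Bj; have m : measurable_fun setT (X j : info X B -> R).
    exact: measurable_info.
  exact: (measurableT_comp m measurable_snd).
apply/measurable_EFinP; apply: measurable_funX; apply: measurable_enorm => i.
have -> : (fun z : info X A * info X B => (noisy_next z.1 z.2 - xs) ord0 i) =
    (fun z => noisy_next z.1 z.2 ord0 i - xs ord0 i).
  by apply/funext => z; rewrite !mxE.
apply: measurable_funB => //; apply: (measurable_noisy_step _ _ fL) => //.
- move=> k; have -> : (fun z : info X A * info X B => U z.1 ord0 k) =
      (fun z => X (e k) z.1) by apply/funext => z; rewrite mxE.
  exact: mA.
- by apply: mB; left.
- by apply: mB; right.
Qed.

Let mean_noise w : has_mean P (fun w' => enorm (noisy_next w w' - xs) ^+ 2)
  (dotv D D - 2 * (h / s * dotv (U w) D) * increment w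
   + (h / s) ^+ 2 * r w * (increment w ^+ 2
      + sigr ^+ 2 * (f (x + s *: U w) ^+ 2 + f x ^+ 2))).
Proof.
apply: has_mean_ext (noise_quadratic _ _ _ _ _ _) => w'.
rewrite enorm_sqr /noisy_next.
pose k := h * ((noisy f (x + s *: U w) (X j1 w') - noisy f x (X j2 w')) / s).
rewrite -/k.
have -> : x - k *: U w - xs = D - k *: U w by rewrite addrAC.
rewrite dotv_subZ.
rewrite -/(r w) /k /increment /noisy; field.
by rewrite lt0r_neq0.
Qed.

Lemma noisy_step_fixed :
  (\int[P]_w (enorm (noisy_next w w - xs) ^+ 2)%:E <= step_bound%:E)%E.
Proof.
rewrite (ge0_info_decouple mX indepX AB
  (F := fun w w' => (enorm (noisy_next w w' - xs) ^+ 2)%:E) mnext); last first.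
  by move=> w w'; rewrite lee_fin sqr_ge0.
have [c hc cge] := mean_descent.
have rowE (v : 'rV[R]_n) : v = \row_i v ord0 i by apply/rowP => i; rewrite mxE.
have [h1 h2 h3 _ hg] := gaussian_vector_moments mX indepX e_inj law (rowE (grad f x)).
have [_ _ _ hD _] := gaussian_vector_moments mX indepX e_inj law (rowE D).
(* A pointwise majorant that is a linear combination of variables whose means are known. *)
pose G w := dotv D D + - (2 * (h / s)) * (dotv (U w) D * f (x + s *: U w))
  + 2 * (h / s) * f x * dotv D (U w)
  + h ^+ 2 * 2 * (dotv (grad f x) (U w) ^+ 2 * r w)
  + h ^+ 2 * (s ^+ 2 * L1 ^+ 2 / 2) * r w ^+ 3
  + h ^+ 2 * sigr ^+ 2 * (4 * f x ^+ 2 / s ^+ 2) * r w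
  + h ^+ 2 * sigr ^+ 2 * (3 / 2 * L0 ^+ 2) * r w ^+ 2.
have hG := has_meanD (has_meanD (has_meanD (has_meanD (has_meanD (has_meanD
  (has_mean_cst P (dotv D D)) (has_meanZ (- (2 * (h / s))) hc))
  (has_meanZ (2 * (h / s) * f x) hD)) (has_meanZ (h ^+ 2 * 2) hg))
  (has_meanZ (h ^+ 2 * (s ^+ 2 * L1 ^+ 2 / 2)) h3))
  (has_meanZ (h ^+ 2 * sigr ^+ 2 * (4 * f x ^+ 2 / s ^+ 2)) h1))
  (has_meanZ (h ^+ 2 * sigr ^+ 2 * (3 / 2 * L0 ^+ 2)) h2).
have {hG} [iG EG] : has_mean P G _ := hG.
have qG w : dotv D D - 2 * (h / s * dotv (U w) D) * increment w
   + (h / s) ^+ 2 * r w * (increment w ^+ 2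
      + sigr ^+ 2 * (f (x + s *: U w) ^+ 2 + f x ^+ 2)) <= G w.
  have i1 := increment_sqr w; have i2 := increment_lip w.
  have fE : f (x + s *: U w) = f x + increment w by rewrite /increment; ring.
  rewrite /G (dotvC D) fE.
  have r0 : 0 <= r w by exact: dotvv_ge0.
  have k0 : 0 <= (h / s) ^+ 2 * r w by rewrite mulr_ge0 ?sqr_ge0.
  have i3 : (f x + increment w) ^+ 2 + f x ^+ 2 <=
      4 * f x ^+ 2 + 3 / 2 * (L0 ^+ 2 * s ^+ 2 * r w).
    have := sqr_ge0 (2 * f x - increment w); rewrite !expr2 in i2 *; lra.
  have i4 : (h / s) ^+ 2 * r w * (increment w ^+ 2
      + sigr ^+ 2 * ((f x + increment w) ^+ 2 + f x ^+ 2)) <=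
    (h / s) ^+ 2 * r w * (s ^+ 2 * (2 * dotv (grad f x) (U w) ^+ 2
      + s ^+ 2 * L1 ^+ 2 / 2 * r w ^+ 2)
      + sigr ^+ 2 * (4 * f x ^+ 2 + 3 / 2 * (L0 ^+ 2 * s ^+ 2 * r w))).
    by rewrite ler_wpM2l// lerD// ler_wpM2l// sqr_ge0.
  rewrite -subr_ge0; rewrite -subr_ge0 in i4; apply: (le_trans i4).
  rewrite le_eqVlt; apply/orP; left; apply/eqP.
  by field; rewrite lt0r_neq0.
apply: (@le_trans _ _ (\int[P]_w (G w)%:E)%E).
  apply: ge0_le_integral => //.
  - by move=> w _; apply: integral_ge0 => w' _; rewrite lee_fin sqr_ge0.
  - have pos w w' : (0 <= (enorm (noisy_next w w' - xs) ^+ 2)%:E)%E.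
      by rewrite lee_fin sqr_ge0.
    exact: (@ge0_info_decouple_measurable _ _ _ P _ _ mX A B
      (fun w w' => (enorm (noisy_next w w' - xs) ^+ 2)%:E) mnext pos).
  - exact: measurable_int iG.
  - by move=> w _; have [_ ->] := mean_noise w; rewrite lee_fin.
rewrite EG lee_fin /step_bound -subr_ge0.
set lhs := (X in 0 <= X).
(* All moments cancel except the inner product, which leaves exactly the inequality of
   [mean_descent]. *)
have -> : lhs = 2 * h * (c - (f x - f xs - L1 / 2 * s ^+ 2 * N)).
  by rewrite /lhs /N; field; rewrite lt0r_neq0.
by rewrite !mulr_ge0// subr_ge0.
Qed.

End fixed_point.

End noisy_step.

(** * Consequences of the bounded support of the noise *)

Section bounded_noise.
Context (d : measure_display) (T : measurableType d) (R : realType).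
Context (P : probability T R) (v : T -> R) (a b sigr : R).
Hypothesis mv : measurable_fun setT v.
Hypothesis a_lt1 : a < 1.
Hypothesis mean_v : ('E_P[v] = 0)%E.
Hypothesis var_v : ('V_P[v] = (sigr ^+ 2)%:E)%E.
Hypothesis inv_v : ('E_P[fun w => ((1 + v w)^-1)%R] <= b%:E)%E.
Hypothesis supp_v : P (v @^-1` `[- a, a]) = 1%E.

Lemma noise_bound : {ae P, forall w, `|v w| <= a}.
Proof.
have mI : measurable (v @^-1` `[- a, a]).
  by rewrite -[X in measurable X]setTI; apply: mv.
exists (~` (v @^-1` `[- a, a])); split.
- exact: measurableC.
- by rewrite probability_setC// supp_v subee.
- by move=> w /=; apply: contra_not; rewrite in_itv/= -ler_norml.
Qed.

Let bounded_integrable (F : R -> R) : measurable_fun setT (F \o v) ->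
  (forall z, `|z| <= 1 -> `|F z| <= 1) ->
  P.-integrable setT (EFin \o (F \o v)).
Proof.
move=> mF F1; apply/integrableP; split; first exact/measurable_EFinP.
apply: (@le_lt_trans _ _ (\int[P]_w (cst 1 w))%E); last first.
  by rewrite integral_cst//= probability_setT mule1 ltry.
apply: ae_ge0_le_integral => //.
- by apply: measurableT_comp => //; exact/measurable_EFinP.
- apply: filterS noise_bound => w va _ /=.
  by rewrite lee_fin F1// (le_trans va)// ltW.
Qed.

Lemma noise_mean : has_mean P v 0.
Proof.
split; first exact: (@bounded_integrable id).
by move: mean_v; rewrite unlock.
Qed.

Lemma noise_sqr_mean : has_mean P (fun w => v w ^+ 2) (sigr ^+ 2).
Proof.
split.
  apply: (@bounded_integrable (fun z => z ^+ 2)).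
    exact: measurable_funX.
  by move=> z z1; rewrite normrX exprn_ile1.
move: var_v; rewrite /variance unlock mean_v unlock => <-.
apply: eq_integral => w _.
have -> : ((v \- cst (fine 0%E)) * (v \- cst (fine 0%E))) w = (v w - 0) * (v w - 0).
  by [].
by rewrite subr0 expr2.
Qed.

Lemma noise_factor_gt0 : {ae P, forall w, 0 < 1 + v w}.
Proof.
apply: filterS noise_bound => w; rewrite ler_norml => /andP[va _].
by have := a_lt1; lra.
Qed.

(** The absolute value makes the integrand nonnegative on all of [T], as Tonelli requires, and does
    not change the mean because 1 + v is almost surely positive. *)
Lemma noise_factor_mean : (\int[P]_w (`|1 + v w|)%:E = 1%:E)%E.
Proof.
have [_ E] := has_meanD (has_mean_cst P 1) noise_mean.
rewrite addr0 in E; rewrite -E; apply: ae_eq_integral => //.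
- apply/measurable_EFinP; apply: measurableT_comp => //.
  exact: measurable_funD.
- by apply/measurable_EFinP; exact: measurable_funD.
- by apply: filterS noise_factor_gt0 => w v0 _; rewrite gtr0_norm.
Qed.

Lemma noise_factor_inv_mean : (\int[P]_w (`|1 + v w|^-1)%:E <= b%:E)%E.
Proof.
move: inv_v; rewrite unlock; apply: le_trans; rewrite le_eqVlt; apply/orP; left.
apply/eqP; apply: ae_eq_integral => //.
- apply/measurable_EFinP; apply: measurable_fun_inv; apply: measurableT_comp => //.
  exact: measurable_funD.
- by apply/measurable_EFinP; apply: measurable_fun_inv; exact: measurable_funD.
- by apply: filterS noise_factor_gt0 => w v0 _; rewrite gtr0_norm.
Qed.

Lemma noise_inv_bound_ge0 : 0 <= b.
Proof.
rewrite -lee_fin (le_trans _ noise_factor_inv_mean)//.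
by apply: integral_ge0 => w _; rewrite lee_fin invr_ge0.
Qed.

End bounded_noise.

(** * Arithmetic of the step size and the constants *)

Section constants.
Context (R : realType) (n : nat) (L0 L1 sigr b : R).
Hypothesis n_gt0 : (0 < n)%N.
Hypothesis L1_gt0 : 0 < L1.
Hypothesis sigr_gt0 : 0 < sigr.
Hypothesis b_ge0 : 0 <= b.
Local Notation h := (stepsize n L1).
Local Notation c4 := (C4 n L1 sigr).

Let N_gt0 : 0 < n%:R :> R. Proof. by rewrite ltr0n. Qed.

Let Q_gt0 : 0 < L1 ^+ 2 * (1 + 3 * sigr ^+ 2) * (n%:R + 6) ^+ 3.
Proof.
have s2 : 0 < sigr ^+ 2 by rewrite exprn_gt0.
by rewrite !mulr_gt0 ?exprn_gt0//; have := N_gt0; lra.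
Qed.

Lemma stepsize_gt0 : 0 < h.
Proof. by rewrite divr_gt0// !mulr_gt0. Qed.

Let ratio_gt0 : 0 < 16 * sigr ^+ 2 * n%:R /
  (L1 ^+ 2 * (1 + 3 * sigr ^+ 2) * (n%:R + 6) ^+ 3).
Proof. by rewrite divr_gt0// !mulr_gt0 ?exprn_gt0. Qed.

Lemma C4_gt0 : 0 < c4.
Proof. by rewrite /C4 !sqrtr_gt0. Qed.

(** The product under the root is the perfect square (4 sigr n / L1)^2. This calibration turns 4
    sigr^2 n / C4^2, the weight of the evaluation noise, into the square-root expression of [C5]. *)
Let C4_sqr : c4 ^+ 2 * (L1 * sigr *
    Num.sqrt ((1 + 3 * sigr ^+ 2) * n%:R * (n%:R + 6) ^+ 3)) =
  4 * sigr ^+ 2 * n%:R.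
Proof.
rewrite /C4 sqr_sqrtr ?sqrtr_ge0//.
have -> : forall p q r : R, p * (q * r) = q * (p * r) by move=> *; ring.
rewrite -sqrtrM ?ltW//.
have -> : 16 * sigr ^+ 2 * n%:R / (L1 ^+ 2 * (1 + 3 * sigr ^+ 2) * (n%:R + 6) ^+ 3)
    * ((1 + 3 * sigr ^+ 2) * n%:R * (n%:R + 6) ^+ 3) = (4 * sigr * n%:R / L1) ^+ 2.
  have s2 := sqr_ge0 sigr; have N0 := N_gt0.
  by field; rewrite !lt0r_neq0//; lra.
rewrite sqrtr_sqr ger0_norm; last by rewrite divr_ge0 ?mulr_ge0// ltW.
by field; rewrite lt0r_neq0.
Qed.

(** The coefficient of E|f(x_k)|: the first summand comes from s^2 with E|1 + nu| = 1, the second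
    from f^2 / s^2 with E[1/|1 + nu|] <= b. *)
Definition noise_coeff : R :=
  (h * L1 * n%:R + h ^+ 2 * (L1 ^+ 2 / 2 * (n%:R + 6) ^+ 3)) * c4 ^+ 2
  + h ^+ 2 * (4 * sigr ^+ 2 * n%:R) / c4 ^+ 2 * b.

Lemma noise_coeff_ge0 : 0 <= noise_coeff.
Proof.
have N0 := ltW N_gt0; have h0 := ltW stepsize_gt0; have l0 := ltW L1_gt0.
rewrite /noise_coeff addr_ge0//.
  apply: mulr_ge0; last exact: sqr_ge0.
  apply: addr_ge0; first by apply: mulr_ge0 => //; apply: mulr_ge0.
  apply: mulr_ge0; first exact: sqr_ge0.
  apply: mulr_ge0; last by rewrite exprn_ge0// addr_ge0.
  by rewrite mulr_ge0 ?sqr_ge0// invr_ge0.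
apply: mulr_ge0 => //; apply: divr_ge0; last exact: sqr_ge0.
apply: mulr_ge0; first exact: sqr_ge0.
by apply: mulr_ge0 => //; apply: mulr_ge0 => //; exact: sqr_ge0.
Qed.

Lemma noise_coeff_le : noise_coeff <= C7 n L1 sigr b.
Proof.
rewrite /noise_coeff /C7 /C5 -subr_ge0.
set q := L1 * sigr * Num.sqrt ((1 + 3 * sigr ^+ 2) * n%:R * (n%:R + 6) ^+ 3).
have q0 : 0 <= q by rewrite /q !mulr_ge0 ?sqrtr_ge0// ltW.
have E : 4 * sigr ^+ 2 * n%:R = c4 ^+ 2 * q by rewrite C4_sqr.
have c0 := C4_gt0; have N0 := N_gt0.
rewrite E.
have -> : (1 + b) * L1 * sigr * Num.sqrt ((1 + 3 * sigr ^+ 2) * n%:R * (n%:R + 6) ^+ 3)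
   = (1 + b) * q by rewrite /q; ring.
set lhs := (X in 0 <= X).
(* [C5] has (1 + b) q where [noise_coeff] has b q, so the difference is exactly h^2 q. *)
have -> : lhs = q / (16 * L1 ^+ 2 * (n%:R + 4) ^+ 2).
  rewrite /lhs /stepsize; field.
  by rewrite !lt0r_neq0//; lra.
apply: divr_ge0 => //; apply: mulr_ge0; last exact: sqr_ge0.
by apply: mulr_ge0 => //; exact: sqr_ge0.
Qed.

Lemma stepsizeV : h^-1 = 4 * L1 * (n%:R + 4).
Proof. by rewrite /stepsize div1r invrK. Qed.

Lemma C8E : C8 n L0 L1 sigr = h ^+ 2 * C6 n L0 sigr.
Proof.
rewrite /C8 /stepsize; field; rewrite !lt0r_neq0//; have := N_gt0; lra.
Qed.

Lemma step_bound_le (f : 'rV[R]_n -> R) (xs x : 'rV[R]_n) (s : R) : 0 < s ->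
  f xs <= f x -> dotv (grad f x) (grad f x) <= 2 * L1 * (f x - f xs) ->
  step_bound sigr f L0 L1 xs x s h + h * (f x - f xs) <=
  dotv (x - xs) (x - xs)
  + (h * L1 * n%:R + h ^+ 2 * (L1 ^+ 2 / 2 * (n%:R + 6) ^+ 3)) * s ^+ 2
  + h ^+ 2 * (4 * sigr ^+ 2 * n%:R) * (f x ^+ 2 / s ^+ 2) + h ^+ 2 * C6 n L0 sigr.
Proof.
move=> s0 fx gx; rewrite /step_bound /C6; have N0 := N_gt0; have h0 := stepsize_gt0.
set D := dotv (x - xs) _; set q := f x ^+ 2 / s ^+ 2.
have -> : 4 * f x ^+ 2 / s ^+ 2 * n%:R = 4 * q * n%:R by rewrite /q; ring.
set G := dotv (grad f x) _ in gx *; set F := f x - f xs in gx *.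
have F0 : 0 <= F by rewrite /F subr_ge0.
have hh : 4 * L1 * (n%:R + 4) * h = 1 by rewrite -stepsizeV mulVf// lt0r_neq0.
(* Here the step size is decisive: 4 L1 (n+4) h = 1 makes the gradient term at most h F, so of the
   decrease 2 h F one copy survives for the left-hand side. *)
have e1 : h ^+ 2 * (2 * (n%:R + 2) * G) <= h * F.
  apply: (@le_trans _ _ (h ^+ 2 * (2 * (n%:R + 4) * (2 * L1 * F)))).
    rewrite ler_wpM2l ?sqr_ge0//.
    apply: ler_pM => //; rewrite ?dotvv_ge0// ?mulr_ge0//; lra.
  have -> : h ^+ 2 * (2 * (n%:R + 4) * (2 * L1 * F)) = h * F * (4 * L1 * (n%:R + 4) * h).
    by ring.
  by rewrite hh mulr1.
have e2 : h ^+ 2 * (s ^+ 2 * L1 ^+ 2 / 2 * (n%:R * (n%:R + 2) * (n%:R + 4))) <=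
    h ^+ 2 * (L1 ^+ 2 / 2 * (n%:R + 6) ^+ 3) * s ^+ 2.
  have -> : h ^+ 2 * (L1 ^+ 2 / 2 * (n%:R + 6) ^+ 3) * s ^+ 2 =
    h ^+ 2 * (s ^+ 2 * L1 ^+ 2 / 2 * (n%:R + 6) ^+ 3) by ring.
  rewrite ler_wpM2l ?sqr_ge0// ler_wpM2l//.
    by apply: mulr_ge0 => //; apply: mulr_ge0; exact: sqr_ge0.
  have -> : (n%:R + 6) ^+ 3 = (n%:R + 6) * (n%:R + 6) * (n%:R + 6) :> R by ring.
  move: N0; generalize (n%:R : R) => N N0.
  have : 0 <= N * N by rewrite mulr_ge0// ltW.
  nra.
have e3 : h ^+ 2 * (sigr ^+ 2 * (3 / 2 * L0 ^+ 2 * (n%:R * (n%:R + 2)))) <=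
    h ^+ 2 * (3 * L0 ^+ 2 * sigr ^+ 2 * (n%:R + 4) ^+ 2).
  rewrite ler_wpM2l ?sqr_ge0//.
  have -> : 3 * L0 ^+ 2 * sigr ^+ 2 * (n%:R + 4) ^+ 2 =
    sigr ^+ 2 * (3 / 2 * L0 ^+ 2 * (2 * (n%:R + 4) ^+ 2)) by field.
  rewrite ler_wpM2l ?sqr_ge0// ler_wpM2l//.
    by apply: mulr_ge0; [lra|exact: sqr_ge0].
  by nra.
move: e1 e2 e3.
have -> : D - 2 * h * (F - L1 / 2 * s ^+ 2 * n%:R) + h ^+ 2 *
   (2 * (n%:R + 2) * G + s ^+ 2 * L1 ^+ 2 / 2 * (n%:R * (n%:R + 2) * (n%:R + 4)) +
    sigr ^+ 2 * (4 * q * n%:R + 3 / 2 * L0 ^+ 2 * (n%:R * (n%:R + 2)))) =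
  D - 2 * h * F + h * L1 * n%:R * s ^+ 2 + h ^+ 2 * (2 * (n%:R + 2) * G)
  + h ^+ 2 * (s ^+ 2 * L1 ^+ 2 / 2 * (n%:R * (n%:R + 2) * (n%:R + 4)))
  + h ^+ 2 * (4 * sigr ^+ 2 * n%:R) * q
  + h ^+ 2 * (sigr ^+ 2 * (3 / 2 * L0 ^+ 2 * (n%:R * (n%:R + 2)))) by field.
rewrite (mulrDl (h * L1 * n%:R)).
lra.
Qed.

End constants.

(** * The random recursion and its telescoping *)

Section iteration.
Context (R : realType) (n : nat) (d : measure_display) (T : measurableType d).
Context (P : probability T R) (f : 'rV[R]_n -> R) (L0 L1 : R) (xs x0 : 'rV[R]_n).
Context (nu : nat -> 'I_3 -> T -> R) (g : nat -> 'I_n -> T -> R) (sigr a b : R).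
Hypothesis n_gt0 : (0 < n)%N.
Hypothesis L1_gt0 : 0 < L1.
Hypothesis cvxf : convex_fun f.
Hypothesis df : forall x, differentiable f x.
Hypothesis fL : forall x y, `|f x - f y| <= L0 * enorm (x - y).
Hypothesis gradL : forall x y, enorm (grad f x - grad f y) <= L1 * enorm (x - y).
Hypothesis fmin : forall y, f xs <= f y.
Hypothesis mnu : forall k j, measurable_fun setT (nu k j).
Hypothesis mg : forall k i, measurable_fun setT (g k i).
Hypothesis indep : mutually_independent P (all_randomness nu g).
Hypothesis sigr_gt0 : 0 < sigr.
Hypothesis a_lt1 : a < 1.
Hypothesis nu_mean : forall k j, ('E_P[nu k j] = 0)%E.
Hypothesis nu_var : forall k j, ('V_P[nu k j] = (sigr ^+ 2)%:E)%E.
Hypothesis nu_inv : forall k j, ('E_P[fun w => ((1 + nu k j w)^-1)%R] <= b%:E)%E.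
Hypothesis nu_supp : forall k j, P (nu k j @^-1` `[- a, a]) = 1%E.
Hypothesis g_law : forall k i (B : set R), measurable B ->
  P (g k i @^-1` B) = normal_prob 0 1 B.

Local Notation c4 := (C4 n L1 sigr).
Local Notation h := (stepsize n L1).
Local Notation x := (iterates f x0 c4 h nu g).

Hypothesis f_neq0 : forall k, {ae P, forall w, f (x k w) != 0}.

Let index := ((nat * 'I_3) + (nat * 'I_n))%type.
Let X : index -> T -> R := all_randomness nu g.

Let mX z : measurable_fun setT (X z).
Proof. by case: z => -[k j]; [exact: mnu|exact: mg]. Qed.

Let past (k : nat) : set index :=
  [set z | match z with inl (m, _) => (m < k)%N | inr (m, _) => (m < k)%N end].

Let mu k w := c4 * Num.sqrt `|noisy f (x k w) (nu_mu nu k w)|.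

Let b_ge0 : 0 <= b.
Proof.
exact: (noise_inv_bound_ge0 (mnu 0 ord0) a_lt1 (nu_inv 0 ord0) (nu_supp 0 ord0)).
Qed.

Let measurable_noisy d' (S : measurableType d') (Y : S -> 'rV[R]_n) (v : S -> R) :
  (forall i, measurable_fun setT (fun s => Y s ord0 i)) -> measurable_fun setT v ->
  measurable_fun setT (fun s => c4 * Num.sqrt `|noisy f (Y s) (v s)|).
Proof.
move=> mY mv; apply: measurable_funM => //; apply: measurable_fun_sqrt.
apply: measurableT_comp => //; apply: measurable_funM.
  exact: (measurable_lipschitz fL).
exact: measurable_funD.
Qed.

(** The superset [A] is quantified inside the induction, so the hypothesis for step k applies to the
    larger information of step k+1. *)
Let iterates_info k (A : set index) : past k `<=` A ->
  forall i, measurable_fun setT ((fun w => x k w ord0 i) : info X A -> R).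
Proof.
elim: k A => [A _ i|k IH A pA i]; first exact: measurable_cst.
have mxk : forall i, measurable_fun setT ((fun w => x k w ord0 i) : info X A -> R).
  apply: IH => z zk; apply: pA; case: z zk => -[m j] /=; exact: leqW.
have mz z : A z -> measurable_fun setT (X z : info X A -> R).
  by move=> Az; apply: measurable_info.
apply: (@measurable_noisy_step _ (info X A) _ _ f L0 h (x k) (gvec g k)
  (mu k) (nu_plus nu k) (nu_base nu k)) => //.
- move=> j; have -> : (fun s => gvec g k s ord0 j) = X (inr (k, j)).
    by apply/funext => s; rewrite mxE.
  by apply: mz; apply: pA => /=.
- apply: (measurable_noisy (S := info X A)) => //.
  by apply: (mz (inl (k, inord 0))); apply: pA => /=.
- by apply: (mz (inl (k, inord 1))); apply: pA => /=.
- by apply: (mz (inl (k, inord 2))); apply: pA => /=.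
Qed.

Lemma iterates_measurable k i : measurable_fun setT (fun w => x k w ord0 i).
Proof. exact: (info_fun mX (@iterates_info k setT (@subsetT _ _) i)). Qed.

Let mfx k : measurable_fun setT (fun w => f (x k w)).
Proof. by apply: (measurable_lipschitz fL); exact: iterates_measurable. Qed.

Let mdist k : measurable_fun setT (fun w => enorm (x k w - xs) ^+ 2).
Proof.
apply: measurable_funX; apply: measurable_enorm => i.
have -> : (fun w => (x k w - xs) ord0 i) = (fun w => x k w ord0 i - xs ord0 i).
  by apply/funext => w; rewrite !mxE.
by apply: measurable_funB => //; exact: iterates_measurable.
Qed.

Let mnoise0 k : measurable_fun setT (fun w => `|1 + nu_mu nu k w|).
Proof. by apply: measurableT_comp => //; apply: measurable_funD => //; exact: mnu. Qed.

Let past_mu_disj k : past k `&` [set inl (k, inord 0)] = set0.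
Proof.
by apply/seteqP; split => // z [pz zE]; move: pz; rewrite zE /past/= ltnn.
Qed.

Let mfx_past k : measurable_fun setT ((fun w => `|f (x k w)|) : info X (past k) -> R).
Proof.
apply: measurableT_comp => //.
apply: (@measurable_lipschitz _ (info X (past k)) _ _ f L0) => //.
exact: iterates_info.
Qed.

Let mnoise0_info k : measurable_fun setT
  ((fun w => `|1 + nu_mu nu k w|) : info X [set inl (k, inord 0)] -> R).
Proof.
apply: measurableT_comp => //; apply: measurable_funD => //.
exact: (@measurable_info _ _ _ _ X [set inl (k, inord 0)] (inl (k, inord 0))).
Qed.

Let mean_mu_sqr k :
  (\int[P]_w (`|f (x k w)| * `|1 + nu_mu nu k w|)%:E = \int[P]_w (`|f (x k w)|)%:E)%E.
Proof.
rewrite (ge0_integral_indepM mX indep (@past_mu_disj k) (@mfx_past k) (@mnoise0_info k))//.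
rewrite (noise_factor_mean (mnu k _) a_lt1 (nu_mean k _) (nu_supp k _)).
by rewrite mule1.
Qed.

Let mean_mu_inv k :
  (\int[P]_w (`|f (x k w)| * `|1 + nu_mu nu k w|^-1)%:E <=
   \int[P]_w (`|f (x k w)|)%:E * b%:E)%E.
Proof.
have minv : measurable_fun setT ((fun w => `|1 + nu_mu nu k w|^-1) :
    info X [set inl (k, inord 0)] -> R).
  by apply: (@measurable_fun_inv _ (info X [set inl (k, inord 0)])); exact: mnoise0_info.
rewrite (ge0_integral_indepM mX indep (@past_mu_disj k) (@mfx_past k) minv)//.
apply: lee_wpmul2l; first by apply: integral_ge0 => w _; rewrite lee_fin.
exact: (noise_factor_inv_mean (mnu k _) a_lt1 (nu_inv k _) (nu_supp k _)).
Qed.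

Let e k (i : 'I_n) : index := inr (k, i).
(** The iterate and its radius are read at [w], the direction and evaluation noises at [w']; on the
    diagonal this is [x k.+1]. *)
Let next k (w w' : T) : 'rV[R]_n :=
  noisy_next X (e k) (inl (k, inord 1)) (inl (k, inord 2)) f (x k w) (mu k w) h w' w'.

(** The noise inside mu_k is grouped with the past, so the radius is a constant while the remaining
    randomness of step k is averaged. *)
Let pastmu k : set index := past k `|` [set inl (k, inord 0)].
Let fresh k : set index :=
  range (e k) `|` [set inl (k, inord 1); inl (k, inord 2)].

Let inord_neq (i j : nat) : (i < 3)%N -> (j < 3)%N -> i != j ->
  inord i != inord j :> 'I_3.
Proof. by move=> i3 j3; apply: contra => /eqP/(congr1 val); rewrite /= !inordK// => ->. Qed.

Let pastmu_disj k : pastmu k `&` fresh k = set0.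
Proof.
apply/seteqP; split => // z [[pz|E0] [[i _ E]|[E|E]]].
- by move: pz; rewrite -E /past/= ltnn.
- by move: pz; rewrite E /past/= ltnn.
- by move: pz; rewrite E /past/= ltnn.
- by move: E; rewrite E0.
- by move: E; rewrite E0 => -[] /eqP; rewrite (negbTE (@inord_neq 0 1 _ _ _)).
- by move: E; rewrite E0 => -[] /eqP; rewrite (negbTE (@inord_neq 0 2 _ _ _)).
Qed.

Let mnext k : measurable_fun setT (fun z : info X (pastmu k) * info X (fresh k) =>
  (enorm (next k z.1 z.2 - xs) ^+ 2)%:E).
Proof.
have mpast F : measurable_fun setT (F : info X (pastmu k) -> R) ->
    measurable_fun setT (fun z : info X (pastmu k) * info X (fresh k) => F z.1).
  by move=> mF; exact: (measurableT_comp mF measurable_fst).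
have mfresh z0 : fresh k z0 -> measurable_fun setT
    (fun z : info X (pastmu k) * info X (fresh k) => X z0 z.2).
  move=> fz; have m : measurable_fun setT (X z0 : info X (fresh k) -> R).
    exact: measurable_info.
  exact: (measurableT_comp m measurable_snd).
have mxk i : measurable_fun setT ((fun w => x k w ord0 i) : info X (pastmu k) -> R).
  by apply: iterates_info => z zk; left.
apply/measurable_EFinP; apply: measurable_funX; apply: measurable_enorm => i.
have -> : (fun z : info X (pastmu k) * info X (fresh k) =>
    (next k z.1 z.2 - xs) ord0 i) =
    (fun z => next k z.1 z.2 ord0 i - xs ord0 i).
  by apply/funext => z; rewrite !mxE.
apply: measurable_funB => //.
apply: (@measurable_noisy_step _
  (info X (pastmu k) * info X (fresh k))%type _ _ f L0 h
  (fun z => x k z.1) (fun z => \row_i X (e k i) z.2)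
  (fun z => mu k z.1) (fun z => X (inl (k, inord 1)) z.2)
  (fun z => X (inl (k, inord 2)) z.2)) => //.
- by move=> j; exact: (mpast _ (mxk j)).
- move=> j; have -> : (fun s : info X (pastmu k) * info X (fresh k) =>
      (\row_i X (e k i) s.2) ord0 j) = (fun z => X (e k j) z.2).
    by apply/funext => s; rewrite mxE.
  by apply: mfresh; left; exists j.
- apply: (mpast (mu k)); apply: (measurable_noisy (S := info X (pastmu k))) => //.
  apply: (@measurable_info _ _ _ _ X (pastmu k) (inl (k, inord 0))).
  by right.
- by apply: mfresh; right; left.
- by apply: mfresh; right; right.
Qed.

(** Only almost sure, since mu_k > 0 needs f(x_k) and 1 + nu to be nonzero. Writing s^2 and f^2 /
    s^2 as products of a past factor and a noise factor prepares the averaging over the noise in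
    mu_k. *)
Let next_bound k : {ae P, forall w,
  (\int[P]_w' (enorm (next k w w' - xs) ^+ 2)%:E + (h * (f (x k w) - f xs))%:E <=
   (enorm (x k w - xs) ^+ 2
    + ((h * L1 * n%:R + h ^+ 2 * (L1 ^+ 2 / 2 * (n%:R + 6) ^+ 3)) * c4 ^+ 2)
      * (`|f (x k w)| * `|1 + nu_mu nu k w|)
    + (h ^+ 2 * (4 * sigr ^+ 2 * n%:R) / c4 ^+ 2)
      * (`|f (x k w)| * `|1 + nu_mu nu k w|^-1)
    + h ^+ 2 * C6 n L0 sigr)%:E)%E}.
Proof.
have v0 := noise_factor_gt0 (mnu k (inord 0)) a_lt1 (nu_supp k (inord 0)).
apply: filterS2 (f_neq0 k) v0 => w fw vw.
have c0 := C4_gt0 n_gt0 L1_gt0 sigr_gt0.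
have s0 : 0 < mu k w.
  by rewrite /mu mulr_gt0// sqrtr_gt0 normr_gt0 mulf_neq0// lt0r_neq0.
have sE : mu k w ^+ 2 = c4 ^+ 2 * (`|f (x k w)| * `|1 + nu_mu nu k w|).
  by rewrite /mu exprMn [X in _ * X]sqr_sqrtr// /noisy normrM.
have step := noisy_step_fixed mX indep
  (e := e k) (j1 := inl (k, inord 1)) (j2 := inl (k, inord 2))
  _ _ _ _ _
  (noise_mean (mnu k (inord 1)) a_lt1 (nu_mean k _) (nu_supp k _))
  (noise_mean (mnu k (inord 2)) a_lt1 (nu_mean k _) (nu_supp k _))
  (noise_sqr_mean (mnu k (inord 1)) a_lt1 (nu_mean k _) (nu_var k _) (nu_supp k _))
  (noise_sqr_mean (mnu k (inord 2)) a_lt1 (nu_mean k _) (nu_var k _) (nu_supp k _))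
  xs L1_gt0 cvxf df fL gradL (x k w) s0 (ltW (stepsize_gt0 n L1_gt0)).
apply: (@le_trans _ _ ((step_bound sigr f L0 L1 xs (x k w) (mu k w) h)%:E +
    (h * (f (x k w) - f xs))%:E)%E).
  apply: leeD => //; apply: step => //.
  - by move=> i j [].
  - by apply/eqP => -[] /eqP; rewrite (negbTE (@inord_neq 1 2 _ _ _)).
  - by move=> i B mB; exact: g_law.
rewrite -EFinD lee_fin.
have := step_bound_le L0 sigr n_gt0 L1_gt0 (xs := xs) (x := x k w) s0 (fmin _)
  (grad_sqr_le df L1_gt0 gradL (x k w) fmin).
move/le_trans; apply; rewrite enorm_sqr sE.
have v1 : 1 + nu_mu nu k w != 0 by exact: lt0r_neq0.
have -> : f (x k w) ^+ 2 = `|f (x k w)| ^+ 2 by rewrite real_normK ?num_real.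
rewrite le_eqVlt; apply/orP; left; apply/eqP; field.
by rewrite !normr_eq0 fw v1 lt0r_neq0.
Qed.

Let V k := (\int[P]_w (enorm (x k w - xs) ^+ 2)%:E)%E.
Let F k := (\int[P]_w (f (x k w) - f xs)%:E)%E.
Let E k := (\int[P]_w (`|f (x k w)|)%:E)%E.

Let gap_ge0 k w : 0 <= f (x k w) - f xs.
Proof. by rewrite subr_ge0. Qed.

(** The gap term is added on the left rather than subtracted on the right, so the inequality makes
    sense even if some of these integrals are infinite. *)
Lemma noisy_step_mean k : (V k.+1 + h%:E * F k <=
  V k + ((noise_coeff n L1 sigr b)%:E * E k + (h ^+ 2 * C6 n L0 sigr)%:E))%E.
Proof.
have pos w w' : (0 <= (enorm (next k w w' - xs) ^+ 2)%:E)%E.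
  by rewrite lee_fin sqr_ge0.
have h0 := stepsize_gt0 n L1_gt0.
have c40 := C4_gt0 n_gt0 L1_gt0 sigr_gt0.
have -> : V k.+1 = (\int[P]_w \int[P]_w' (enorm (next k w w' - xs) ^+ 2)%:E)%E.
  exact: (ge0_info_decouple mX indep (@pastmu_disj k)
    (F := fun w w' => (enorm (next k w w' - xs) ^+ 2)%:E) (@mnext k) pos).
have mgap : measurable_fun setT (fun w => (f (x k w) - f xs)%:E).
  by apply/measurable_EFinP; apply: measurable_funB => //; exact: mfx.
have -> : (h%:E * F k = \int[P]_w (h * (f (x k w) - f xs))%:E)%E.
  rewrite /F -ge0_integralZl//; last 2 first.
  - by move=> w _; rewrite lee_fin.
  - by rewrite lee_fin ltW.
have mhgap : measurable_fun setT (fun w => (h * (f (x k w) - f xs))%:E).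
  apply/measurable_EFinP; apply: measurable_funM => //.
  by apply: measurable_funB => //; exact: mfx.
have minner : measurable_fun setT
    (fun w => \int[P]_w' (enorm (next k w w' - xs) ^+ 2)%:E)%E.
  exact: (@ge0_info_decouple_measurable _ _ _ P _ _ mX (pastmu k) (fresh k)
    (fun w w' => (enorm (next k w w' - xs) ^+ 2)%:E) (@mnext k) pos).
rewrite -ge0_integralD//; last 2 first.
- by move=> w _; apply: integral_ge0.
- by move=> w _; rewrite lee_fin mulr_ge0// ltW.
pose c1 := (h * L1 * n%:R + h ^+ 2 * (L1 ^+ 2 / 2 * (n%:R + 6) ^+ 3)) * c4 ^+ 2.
pose c2 := h ^+ 2 * (4 * sigr ^+ 2 * n%:R) / c4 ^+ 2.
have c1_ge0 : 0 <= c1.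
  apply: mulr_ge0; last exact: sqr_ge0.
  apply: addr_ge0; first by apply: mulr_ge0 => //; apply: mulr_ge0; exact: ltW.
  apply: mulr_ge0; first exact: sqr_ge0.
  apply: mulr_ge0; last by rewrite exprn_ge0// addr_ge0.
  by rewrite mulr_ge0 ?sqr_ge0// invr_ge0.
have c2_ge0 : 0 <= c2.
  apply: divr_ge0; last exact: sqr_ge0.
  apply: mulr_ge0; first exact: sqr_ge0.
  by apply: mulr_ge0 => //; apply: mulr_ge0 => //; exact: sqr_ge0.
have g_ge0 : 0 <= h ^+ 2 * C6 n L0 sigr.
  apply: mulr_ge0; first exact: sqr_ge0.
  rewrite /C6; apply: mulr_ge0; last exact: sqr_ge0.
  apply: mulr_ge0; last exact: sqr_ge0.
  by apply: mulr_ge0 => //; exact: sqr_ge0.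
pose p w := `|f (x k w)| * `|1 + nu_mu nu k w|.
pose q w := `|f (x k w)| * `|1 + nu_mu nu k w|^-1.
have mabs : measurable_fun setT (fun w => `|f (x k w)|).
  by apply: measurableT_comp => //; exact: mfx.
have mp : measurable_fun setT (fun w => (p w)%:E).
  by apply/measurable_EFinP; apply: measurable_funM => //; exact: mnoise0.
have mq : measurable_fun setT (fun w => (q w)%:E).
  apply/measurable_EFinP; apply: measurable_funM => //; apply: measurable_fun_inv.
  exact: mnoise0.
have p0 w : 0 <= p w by rewrite mulr_ge0.
have q0 w : 0 <= q w by rewrite mulr_ge0// invr_ge0.
have md : measurable_fun setT (fun w => (enorm (x k w - xs) ^+ 2)%:E).
  by apply/measurable_EFinP; exact: mdist.
have mcp : measurable_fun setT (fun w => c1%:E * (p w)%:E)%E.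
  exact: measurable_funeM.
have mcq : measurable_fun setT (fun w => c2%:E * (q w)%:E)%E.
  exact: measurable_funeM.
apply: (@le_trans _ _ (\int[P]_w ((enorm (x k w - xs) ^+ 2)%:E + (c1%:E * (p w)%:E
    + (c2%:E * (q w)%:E + (h ^+ 2 * C6 n L0 sigr)%:E))))%E).
  apply: ae_ge0_le_integral => //.
  - by move=> w _; rewrite adde_ge0// ?integral_ge0// lee_fin mulr_ge0// ltW.
  - exact: emeasurable_funD.
  - move=> w _; rewrite -!EFinM -!EFinD lee_fin.
    by rewrite !addr_ge0 ?sqr_ge0// mulr_ge0.
  - apply: emeasurable_funD => //; apply: emeasurable_funD => //.
    exact: emeasurable_funD.
  - apply: filterS (next_bound k) => w + _; move/le_trans; apply.
    have E4 (A B C D : R) : (A%:E + (B%:E + (C%:E + D%:E)) = (A + B + C + D)%:E)%E.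
      by rewrite -!EFinD !addrA.
    by rewrite -!EFinM E4.
rewrite ge0_integralD//; last 3 first.
- by move=> w _; rewrite lee_fin sqr_ge0.
- move=> w _; rewrite -!EFinM -!EFinD lee_fin.
  by rewrite !addr_ge0// mulr_ge0.
- by apply: emeasurable_funD => //; exact: emeasurable_funD.
apply: leeD => //.
rewrite ge0_integralD//; last 3 first.
- by move=> w _; rewrite -EFinM lee_fin mulr_ge0.
- by move=> w _; rewrite -EFinM -EFinD lee_fin addr_ge0// mulr_ge0.
- exact: emeasurable_funD.
rewrite [X in (_ + X <= _)%E]ge0_integralD//; last first.
  by move=> w _; rewrite -EFinM lee_fin mulr_ge0.
rewrite (has_mean_cst P (h ^+ 2 * C6 n L0 sigr)).2 addeA; apply: leeD => //.
rewrite ge0_integralZl//; last by move=> w _; rewrite lee_fin.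
rewrite [X in (_ + X <= _)%E]ge0_integralZl//; last by move=> w _; rewrite lee_fin.
rewrite mean_mu_sqr -/(E k).
have -> : noise_coeff n L1 sigr b = c1 + c2 * b by [].
have E0 : (0 <= E k)%E by apply: integral_ge0 => w _; rewrite lee_fin.
rewrite EFinD ge0_muleDl; [|by rewrite lee_fin|by rewrite lee_fin; apply: mulr_ge0].
apply: leeD => //; rewrite (EFinM c2 b) -(muleA c2%:E); apply: lee_wpmul2l.
  by rewrite lee_fin.
by rewrite [(b%:E * _)%E]muleC; exact: mean_mu_inv.
Qed.

Lemma noisy_telescope m : (V m + h%:E * \sum_(0 <= k < m) F k <=
  V 0 + \sum_(0 <= k < m)
    ((noise_coeff n L1 sigr b)%:E * E k + (h ^+ 2 * C6 n L0 sigr)%:E))%E.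
Proof.
have F0 k : (0 <= F k)%E by apply: integral_ge0 => w _; rewrite lee_fin.
have h0 := stepsize_gt0 n L1_gt0.
elim: m => [|m IH]; first by rewrite !big_nil mule0 !adde0.
rewrite big_nat_recr//= [in leRHS]big_nat_recr//=.
rewrite ge0_muleDr; [|exact: sume_ge0|exact: F0].
rewrite [(h%:E * \sum_(0 <= i < m) F i + _)%E]addeC addeA.
apply: (le_trans (leeD (noisy_step_mean m) (lexx _))).
rewrite addeAC; apply: (le_trans (leeD IH (lexx _))).
by rewrite -addeA; exact: lexx.
Qed.

End iteration.

(** * From the telescoped inequality to the averaged bound *)

Theorem theorem4 (R : realType) (n : nat) (d : measure_display)
  (T : measurableType d) (P : probability T R)
  (f : 'rV[R]_n -> R) (L0 L1 : R) (xs x0 : 'rV[R]_n)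
  (nu : nat -> 'I_3 -> T -> R) (g : nat -> 'I_n -> T -> R)
  (sigr a b : R) (N : nat) (M : R) :
  (0 < n)%N -> 0 < L1 ->
  (* f convex, continuously differentiable, Lipschitz, L1-smooth *)
  convex_fun f ->
  (forall x, differentiable f x) -> continuous (grad f) ->
  (forall x y, `|f x - f y| <= L0 * enorm (x - y)) ->
  (forall x y, enorm (grad f x - grad f y) <= L1 * enorm (x - y)) ->
  (* xs is a minimizer *)
  (forall y, f xs <= f y) ->
  (* all randomness is measurable and mutually independent *)
  (forall k j, measurable_fun setT (nu k j)) ->
  (forall k i, measurable_fun setT (g k i)) ->
  mutually_independent P (all_randomness nu g) ->
  (* the noises are identically distributed, with the stated moments/support *)
  (forall k j k' j' (B : set R), measurable B ->
     P (nu k j @^-1` B) = P (nu k' j' @^-1` B)) ->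
  0 < sigr -> a < 1 ->
  (forall k j, ('E_P[nu k j] = 0)%E) ->
  (forall k j, ('V_P[nu k j] = (sigr ^+ 2)%:E)%E) ->
  (forall k j, ('E_P[fun w => ((1 + nu k j w)^-1)%R] <= b%:E)%E) ->
  (forall k j, P (nu k j @^-1` `[- a, a]) = 1%E) ->
  (* standard Gaussian vectors u_k = (g k i)_i *)
  (forall k i (B : set R), measurable B ->
     P (g k i @^-1` B) = normal_prob 0 1 B) ->
  let x := iterates f x0 (C4 n L1 sigr) (stepsize n L1) nu g in
  (* f(x_k) <> 0 along the iterates (almost surely) *)
  (forall k, {ae P, forall w, f (x k w) != 0}) ->
  let phi := fun k => if k is 0%N then (f x0)%:E else ('E_P[fun w => f (x k w)])%E in
  (M%:E >= (N.+1%:R^-1)%:E *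
     ((`|f x0|)%R%:E + \sum_(1 <= k < N.+1) 'E_P[fun w => (`|f (x k w)|)%R]))%E ->
  ((N.+1%:R^-1)%:E * \sum_(0 <= k < N.+1) (phi k - (f xs)%:E)
   <= (4 * L1 * (n%:R + 4) / N.+1%:R * enorm (x0 - xs) ^+ 2
       + 4 * L1 * (n%:R + 4) * (C7 n L1 sigr b * M + C8 n L0 L1 sigr))%:E)%E.
Proof.
move=> n0 L10 cvxf df _ fL gradL fmin mnu mg indep _ sigr0 a1 nu_mean nu_var nu_inv
  nu_supp g_law x f_neq0 phi hM.
have b0 := noise_inv_bound_ge0 (mnu 0 ord0) a1 (nu_inv 0 ord0) (nu_supp 0 ord0).
pose h := stepsize n L1; pose A := noise_coeff n L1 sigr b.
pose G := h ^+ 2 * C6 n L0 sigr.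
have h0 : 0 < h := stepsize_gt0 n L10.
pose F k := (\int[P]_w (f (x k w) - f xs)%:E)%E.
pose E k := (\int[P]_w (`|f (x k w)|)%:E)%E.
have tele : ((\int[P]_w (enorm (x N.+1 w - xs) ^+ 2)%:E)
    + h%:E * \sum_(0 <= k < N.+1) F k <= (\int[P]_w (enorm (x 0 w - xs) ^+ 2)%:E)
    + \sum_(0 <= k < N.+1) (A%:E * E k + G%:E))%E.
  exact: (noisy_telescope n0 L10 cvxf df fL gradL fmin mnu mg indep sigr0 a1
    nu_mean nu_var nu_inv nu_supp g_law f_neq0).
have cstE (c : R) : (\int[P]_w c%:E = c%:E)%E := (has_mean_cst P c).2.
have E_ge0 k : (0 <= E k)%E by apply: integral_ge0 => w _; rewrite lee_fin.
have F_ge0 k : (0 <= F k)%E.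
  by apply: integral_ge0 => w _; rewrite lee_fin subr_ge0.
have {hM} totM : ((N.+1%:R^-1)%:E * \sum_(0 <= k < N.+1) E k <= M%:E)%E.
  have E0 : E 0%N = (`|f x0|)%:E := cstE `|f x0|.
  rewrite big_ltn// E0.
  suff -> : (\sum_(1 <= k < N.+1) E k =
    \sum_(1 <= k < N.+1) 'E_P[fun w => (`|f (x k w)|)%R])%E by [].
  by apply: eq_bigr => k _; rewrite unlock.
have Ni0 : 0 < N.+1%:R^-1 :> R by rewrite invr_gt0.
(* An infinite sum would stay infinite after division by N+1 and contradict the finite bound [M]. *)
have totfin : (\sum_(0 <= k < N.+1) E k)%E \is a fin_num.
  have := totM; have : (0 <= \sum_(0 <= k < N.+1) E k)%E by exact: sume_ge0.
  case: (\sum_(0 <= k < N.+1) E k)%E => [r| |] //.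
  by rewrite gt0_muley ?lte_fin.
have Efin k : (k < N.+1)%N -> E k \is a fin_num.
  move=> kN; move/sum_fin_numP : totfin; apply => //.
  by rewrite mem_index_iota.
have mfx k : measurable_fun setT (fun w => f (x k w)).
  apply: (measurable_lipschitz fL).
  exact: (iterates_measurable L1 x0 sigr fL mnu mg k).
(* Finiteness of E|f(x_k)| makes f(x_k) integrable, so subtracting f xs commutes with the
   expectation; at k = 0 the iterate is constant. *)
have phiE k : (k < N.+1)%N -> (phi k - (f xs)%:E = F k)%E.
  move=> kN.
  have ix : P.-integrable setT (fun w => (f (x k w))%:E).
    apply/integrableP; split; first by apply/measurable_EFinP.
    by have := Efin _ kN; rewrite ge0_fin_numE.
  have -> : F k = (\int[P]_w (f (x k w))%:E - (f xs)%:E)%E.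
    rewrite -[in RHS](cstE (f xs)) -integralB//.
    exact: finite_measure_integrable_cst.
  congr (_ - _)%E; rewrite /phi; case: k {kN ix} => [|k].
    exact: (esym (cstE (f x0))).
  by rewrite unlock.
have -> : (\sum_(0 <= k < N.+1) (phi k - (f xs)%:E) = \sum_(0 <= k < N.+1) F k)%E.
  by apply: eq_big_nat => k /andP[_ kN]; exact: phiE.
have sumG : (\sum_(0 <= k < N.+1) (A%:E * E k + G%:E) =
    A%:E * \sum_(0 <= k < N.+1) E k + (N.+1%:R * G)%:E)%E.
  rewrite big_split/= -ge0_sume_distrr//; congr (_ + _)%E.
  by rewrite sumEFin sumr_const_nat subn0 mulr_natl.
have V0 : (\int[P]_w (enorm (x 0%N w - xs) ^+ 2)%:E = (enorm (x0 - xs) ^+ 2)%:E)%E.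
  exact: (cstE (enorm (x0 - xs) ^+ 2)).
rewrite sumG V0 in tele.
have V_ge0 : (0 <= \int[P]_w (enorm (x N.+1 w - xs) ^+ 2)%:E)%E.
  by apply: integral_ge0 => w _; rewrite lee_fin sqr_ge0.
have {V_ge0} tele : (h%:E * \sum_(0 <= k < N.+1) F k <=
    (enorm (x0 - xs) ^+ 2)%:E + (A%:E * \sum_(0 <= k < N.+1) E k
      + (N.+1%:R * G)%:E))%E.
  by apply: le_trans tele; rewrite leeDr.
move: totM totfin tele.
have : (0 <= \sum_(0 <= k < N.+1) F k)%E by exact: sume_ge0.
have : (0 <= \sum_(0 <= k < N.+1) E k)%E by exact: sume_ge0.
case: (\sum_(0 <= k < N.+1) E k)%E => [t| |] // t0.
(* The total gap cannot be infinite, because the right-hand side of [tele] is already a real number;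
   the rest is real arithmetic. *)
case: (\sum_(0 <= k < N.+1) F k)%E => [s| |] // s0; last first.
  by rewrite gt0_muley ?lte_fin.
rewrite -!EFinM -!EFinD !lee_fin => tM _ tele.
rewrite lee_fin in t0.
have M0 : 0 <= M by apply: le_trans tM; rewrite mulr_ge0// ltW.
have A0 : 0 <= A by exact: noise_coeff_ge0.
have AC : A <= C7 n L1 sigr b by exact: noise_coeff_le.
have -> : C8 n L0 L1 sigr = G by exact: C8E.
have <- : h^-1 = 4 * L1 * (n%:R + 4) by exact: stepsizeV.
have N0 : 0 < N.+1%:R :> R by [].
have -> : h^-1 / N.+1%:R * enorm (x0 - xs) ^+ 2 + h^-1 * (C7 n L1 sigr b * M + G) =
    h^-1 * (N.+1%:R^-1 * (enorm (x0 - xs) ^+ 2) + C7 n L1 sigr b * M + G) by ring.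
rewrite -(ler_pM2l h0) mulVKf ?lt0r_neq0//.
have -> : h * (N.+1%:R^-1 * s) = N.+1%:R^-1 * (h * s) by ring.
apply: (@le_trans _ _ (N.+1%:R^-1 * (enorm (x0 - xs) ^+ 2 + (A * t + N.+1%:R * G)))).
  by rewrite ler_pM2l.
have -> : N.+1%:R^-1 * (enorm (x0 - xs) ^+ 2 + (A * t + N.+1%:R * G)) =
    N.+1%:R^-1 * enorm (x0 - xs) ^+ 2 + A * (N.+1%:R^-1 * t) + G.
  by field; rewrite lt0r_neq0.
rewrite !lerD//; apply: (@le_trans _ _ (A * M)); first by rewrite ler_wpM2l.
by rewrite ler_wpM2r.
Qed.
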